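(* Let $\alpha>0$. A positive random variable $Y$ with $EY^{\alpha+\delta}<\infty$ for some $\delta>0$ is $\alpha$-regular variation determining if and only if $$E[Y^{\alpha+i\theta}]\neq0\qquad\text{for all }\theta\in\mathbb{R}.$$
   Context: A random variable $Z$ is regularly varying with exponent $\alpha$ if its right tail satisfies $P(Z>x)=x^{-\alpha}L(x)$ for $x>0$, where $L$ is slowly varying at infinity, i.e. $L$ is eventually positive and $L(cx)/L(x)\to1$ as $x\to\infty$ for every $c>0$. Let $\alpha>0$ and let $Y$ be a positive random variable satisfying $EY^{\alpha+\delta}<\infty$ for some $\delta>0$. $Y$ (and its distribution) is called $\alpha$-regular variation determining if for any random variable $Z$ independent of $Y$, regular variation of $X=YZ$ with exponent $\alpha$ implies that $Z$ itself is regularly varying with exponent $\alpha$. *)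

(* Defs.v *)
From HB Require Import structures.
From mathcomp Require Import all_boot all_order all_algebra.
From mathcomp Require Import all_classical all_reals all_analysis.
From mathcomp.real_closed Require Export complex.
Export numFieldNormedType.Exports.
Export Order.TTheory GRing.Theory Num.Theory.

Set Implicit Arguments.
Unset Strict Implicit.
Unset Printing Implicit Defensive.

Local Open Scope classical_set_scope.
Local Open Scope ring_scope.

Definition slowly_varying (R : realType) (L : R -> R) : Prop :=
  (\forall x \near +oo, 0 < L x) /\
  (forall c : R, 0 < c -> L (c * x) / L x @[x --> +oo] --> (1 : R)).

(* Only the right tail is constrained, so [X] may take negative values. *)
Definition regularly_varying d (T : measurableType d) (R : realType)
    (P : probability T R) (alpha : R) (X : T -> R) : Prop :=
  exists2 L : R -> R, slowly_varying L &
    forall x : R, 0 < x ->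
      P [set w | x < X w] = (x `^ (- alpha) * L x)%:E.

Definition independent_RV d (T : measurableType d) (R : realType)
    (P : probability T R) (Y Z : {RV P >-> R}) : Prop :=
  forall A B : set R, measurable A -> measurable B ->
    P (Y @^-1` A `&` Z @^-1` B) = (P (Y @^-1` A) * P (Z @^-1` B))%E.

(* The property belongs to the distribution [mu] of [Y]: the independent pair
   (Y, Z) ranges over all probability spaces, since the space on which a
   particular copy of [Y] lives may be too small to carry an independent [Z].
   Distributions are compared on measurable sets only, because a measure has
   unspecified values on the other sets. *)
Definition rv_determining (R : realType) (alpha : R)
    (mu : probability R R) : Prop :=
  forall d (T : measurableType d) (P : probability T R) (Y Z : {RV P >-> R}),
    (forall A : set R, measurable A -> distribution P Y A = mu A) ->
    independent_RV Y Z ->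
    regularly_varying P alpha (fun w => Y w * Z w) ->
    regularly_varying P alpha Z.

(* x ^ z = exp (z * ln x), meaningful for x > 0. *)
Definition cpowR (R : realType) (x : R) (z : R[i]) : R[i] :=
  Complex (x `^ complex.Re z * cos (complex.Im z * ln x))
          (x `^ complex.Re z * sin (complex.Im z * ln x)).

(* Meaningful when the real and imaginary parts are both integrable. *)
Definition cexpectation d (T : measurableType d) (R : realType)
    (P : probability T R) (X : T -> R[i]) : R[i] :=
  Complex (fine 'E_P[fun w => complex.Re (X w)])
          (fine 'E_P[fun w => complex.Im (X w)]).

(* Main.v *)
Require Import Defs.
From HB Require Import structures.
From mathcomp Require Import all_boot all_order all_algebra.
From mathcomp Require Import all_classical all_reals all_analysis.
From mathcomp Require Import measurable_realfun.
From mathcomp.real_closed Require Import complex.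
From mathcomp Require Import ring lra.

(** Write W = Y^alpha, S = ln Y, let [mu] be the law of Y and put m = E[Y^alpha].
    With G the tail of Z, the tail of X = YZ is H(x) = E[G(x / Y)], and the
    transform of the statement is k(theta) = E[W exp(i theta S)], whose real and
    imaginary parts are [cos_transform] and [sin_transform].

    Sufficiency is a Tauberian argument.  Suppose that H(x) = x^-alpha L(x) with
    L slowly varying, and consider, as x goes to infinity, the rescaled tails
    r_x(s) = exp(alpha s) G(x exp(s)) / H(x).  Disintegrating X over Y gives
    E[W r_x(v - S)] = exp(alpha v) H(x exp(v)) / H(x), which tends to 1 for every
    v; the claim is that r_x(0) = G(x) / H(x) tends to 1 / m, for then G inherits
    the regular variation of H.  So one must undo the convolution with the
    weighted law of S.  Since Y has moments on both sides of alpha, every W |S|^n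
    is integrable, k is smooth, and 1 / k is smooth because k has no zero.  Hence
    for each Fejer kernel, whose Fourier transform is a triangle on [-l, l], the
    quotient of that triangle by k is the transform of an integrable psi, with
    E[W psi(t + S)] equal to the kernel ([fejer_division]): two integrations by
    parts give psi a decay in 1 / t^2, and no inversion theorem is needed because
    psi is defined by an explicit integral.  By Fubini, the Fejer means of r_x are
    integrals against psi of functions converging to 1, so they converge to
    (integral of the kernel) / m ([fejer_smoothed_cvg]).  As G is monotone,
    exp(- alpha s) r_x(s) is nonincreasing in s, and narrow Fejer means control
    the value at 0 ([tauberian]).

    Dominated convergence in this argument requires bounded functions, so r_x
    is truncated at a level K that eventually exceeds r_x(s) for every fixed s;
    the loss in E[W r_x(v - S)] vanishes in the limit thanks to the Potter-type
    bound G(z) <= C (x / z)^(alpha + delta) H(x) for z <= x ([potter_bound]), and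
    to E[Y^(alpha + delta)] being finite.

    Necessity is a construction.  If k(t) = 0, then t is nonzero, and Z with tail
    x^-alpha (1 + a cos(t ln x)) / (1 + a) on [1, +oo[ is not regularly varying,
    because of the oscillation.  For x / Y >= 1 the oscillating term contributes
    to P(YZ > x) the quantity x^-alpha a E[W cos(t (ln x - S))] / (1 + a), which
    is zero, and the event x / Y < 1 is negligible by the moment of order
    alpha + delta.  Hence x^alpha P(YZ > x) has a positive limit
    ([oscillating_product_tail]), and Y is not determining. *)

Set Implicit Arguments.
Unset Strict Implicit.
Unset Printing Implicit Defensive.
Local Open Scope classical_set_scope.
Local Open Scope ring_scope.

(** * Integration: domination, almost everywhere comparison, translation *)

Section integration.
Context d (T : measurableType d) (R : realType).
Variable mu : {measure set T -> \bar R}.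

Lemma integrable_dominated (f g : T -> R) :
  measurable_fun setT f -> mu.-integrable setT (EFin \o g) ->
  (forall x, `|f x| <= g x) -> mu.-integrable setT (EFin \o f).
Proof.
move=> mf ig fg; apply: le_integrable ig => //.
  exact/measurable_EFinP.
by move=> x _ /=; rewrite lee_fin (le_trans (fg x))// ler_norm.
Qed.

Lemma integrableRZl (c : R) (f : T -> R) : mu.-integrable setT (EFin \o f) ->
  mu.-integrable setT (EFin \o (fun x => c * f x)).
Proof.
move=> fi; rewrite (_ : _ \o _ = (fun x => c%:E * (EFin \o f) x)%E).
  exact: integrableZl.
by apply/funext => x; rewrite /= EFinM.
Qed.

Lemma integrableRZr (c : R) (f : T -> R) : mu.-integrable setT (EFin \o f) ->
  mu.-integrable setT (EFin \o (fun x => f x * c)).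
Proof. by under eq_fun do rewrite mulrC; exact: integrableRZl. Qed.

Lemma integrableRD (f g : T -> R) : mu.-integrable setT (EFin \o f) ->
  mu.-integrable setT (EFin \o g) ->
  mu.-integrable setT (EFin \o (fun x => f x + g x)).
Proof.
move=> fi gi; rewrite (_ : _ \o _ = ((EFin \o f) \+ (EFin \o g))%E).
  exact: integrableD.
by apply/funext => x; rewrite /= EFinD.
Qed.

Lemma integrableRB (f g : T -> R) : mu.-integrable setT (EFin \o f) ->
  mu.-integrable setT (EFin \o g) ->
  mu.-integrable setT (EFin \o (fun x => f x - g x)).
Proof.
move=> fi gi; rewrite (_ : _ \o _ = ((EFin \o f) \- (EFin \o g))%E).
  exact: integrableB.
by apply/funext => x; rewrite /= EFinB.
Qed.

Lemma dominated_cvg_Rintegral (f_ : nat -> T -> R) (f g : T -> R) :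
  (forall n, measurable_fun setT (f_ n)) -> measurable_fun setT f ->
  mu.-integrable setT (EFin \o g) ->
  {ae mu, forall x n, `|f_ n x| <= g x} ->
  {ae mu, forall x, f_ n x @[n --> \oo] --> f x} ->
  \int[mu]_x f_ n x @[n --> \oo] --> \int[mu]_x f x.
Proof.
move=> mf_ mf ig fg fcvg.
have [|||||intf _ cvgf] := @dominated_convergence _ _ _ mu setT measurableT
  (fun n x => (f_ n x)%:E) (EFin \o f) (EFin \o g).
- by move=> n; exact/measurable_EFinP.
- exact/measurable_EFinP.
- by apply: filterS fcvg => x fx _; apply: cvg_EFin => //; exact: nearW.
- exact: ig.
- by apply: filterS fg => x fx n _; rewrite /= lee_fin.
apply: fine_cvg; rewrite fineK//.
exact: integrable_fin_num.
Qed.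

Lemma eq_ae_Rintegral (f g : T -> R) :
  measurable_fun setT f -> measurable_fun setT g ->
  {ae mu, forall x, f x = g x} -> \int[mu]_x f x = \int[mu]_x g x.
Proof.
move=> mf mg fg; congr fine; apply: ae_eq_integral => //.
- exact/measurable_EFinP.
- exact/measurable_EFinP.
- by apply: filterS fg => x -> _.
Qed.

Lemma integrable_normr (f : T -> R) : mu.-integrable setT (EFin \o f) ->
  mu.-integrable setT (EFin \o (fun w => `|f w|)).
Proof. exact: integrable_abse. Qed.

Lemma ae_le_Rintegral (f g : T -> R) :
  mu.-integrable setT (EFin \o f) -> mu.-integrable setT (EFin \o g) ->
  {ae mu, forall x, f x <= g x} -> \int[mu]_x f x <= \int[mu]_x g x.
Proof.
move=> fi gi fg.
have mf : measurable_fun setT f by have /measurable_int/measurable_EFinP := fi.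
have mg : measurable_fun setT g by have /measurable_int/measurable_EFinP := gi.
have mM : measurable_fun setT (fun x => Num.max (f x) (g x)) by exact: measurable_maxr.
rewrite -(@eq_ae_Rintegral (fun x => Num.max (f x) (g x)) g)//.
  apply: le_Rintegral => //; last by move=> x _; rewrite le_max lexx.
  apply: (@integrable_dominated _ (fun x => `|f x| + `|g x|)) => //.
    by apply: integrableRD; exact: integrable_normr.
  by move=> x; rewrite /Num.max; case: ifP => _; rewrite ?lerDl ?lerDr.
by apply: filterS fg => x /max_r.
Qed.

End integration.

Lemma measurable_inv (R : realType) : measurable_fun setT (fun y : R => y^-1).
Proof.
have -> : (fun y : R => y^-1) = (fun y => if y < 0 then - ((- y) `^ (-1)) else y `^ (-1)).
  apply/funext => y; have [y0|y0] := ltrP y 0.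
    by rewrite powR_inv1 ?oppr_ge0 ?ltW// invrN opprK.
  by rewrite powR_inv1.
apply: measurable_fun_ifT.
- exact: measurable_fun_ltr.
- apply: measurable_funN; apply: (measurableT_comp (measurable_powR (-1))).
  exact: measurable_funN.
- exact: measurable_powR.
Qed.

Section translation.
Context (R : realType).
Notation leb := (@lebesgue_measure R).

Lemma lebesgue_measure_translation (c : R) (A : set R) : measurable A ->
  pushforward leb (fun s => s + c : measurableTypeR R) A = leb A.
Proof.
move=> mA.
have mt : measurable_fun setT (fun s : measurableTypeR R => s + c : measurableTypeR R).
  exact: measurable_funD.
pose mt_mixin := isMeasurableFun.Build _ _ _ _ _ mt.
pose mt_pack : {mfun _ >-> _} := HB.pack (fun s : measurableTypeR R => s + c : measurableTypeR R) mt_mixin.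
apply/esym/(@lebesgue_measure_unique R (pushforward leb mt_pack)) => //= _ [[a b]] _ <-.
rewrite /pushforward.
have -> : (fun s => s + c) @^-1` `]a, b]%classic = `](a - c), (b - c)]%classic.
  by apply/seteqP; split => x /=; rewrite !in_itv/= ltrBlDr lerBrDr.
rewrite !lebesgue_measure_itv/= !lte_fin ltrD2r.
by case: ifP => // _; rewrite -!EFinB; congr EFin; lra.
Qed.

Lemma integral_translation (f : R -> \bar R) (c : R) :
  measurable_fun setT f -> (forall s, 0 <= f s)%E ->
  (\int[leb]_s f (s + c)%R = \int[leb]_s f s)%E.
Proof.
move=> mf f0.
transitivity (\int[pushforward leb (fun s => (s + c)%R : measurableTypeR R)]_s f s)%E.
  rewrite ge0_integral_pushforward//.
  exact: measurable_funD.
apply: eq_measure_integral => [|mt A mA _]; first exact: measurable_funD.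
exact: lebesgue_measure_translation.
Qed.

Lemma Rintegral_translation (f : R -> R) (c : R) :
  leb.-integrable setT (EFin \o f) ->
  leb.-integrable setT (fun s => (f (s + c))%:E) /\
  \int[leb]_s f (s + c) = \int[leb]_s f s.
Proof.
move=> intf.
have mt : measurable_fun setT (fun s : R => s + c) by exact: measurable_funD.
have mf : measurable_fun setT f by have /measurable_int/measurable_EFinP := intf.
have int1 : leb.-integrable setT (fun s => (f (s + c))%:E).
  apply/integrableP; split.
    by apply/measurable_EFinP; exact: measurableT_comp mf mt.
  have /integrableP[_] := intf; apply: le_lt_trans.
  rewrite -(@integral_translation (fun s => `|(EFin \o f) s|%E) c)//.
  by apply: measurableT_comp => //; exact/measurable_EFinP.
split=> //; congr fine.
transitivity (\int[pushforward leb (fun s => (s + c)%R : measurableTypeR R)]_s (f s)%:E)%E.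
  rewrite (@integral_pushforward _ _ _ _ _ (fun s : measurableTypeR R => s + c : measurableTypeR R))//.
  exact/measurable_EFinP.
by apply: eq_measure_integral => A mA _; exact: lebesgue_measure_translation.
Qed.

End translation.

(** * Functions of class C^n and decay of oscillatory integrals *)

Section smoothness.
Context (R : realType).
Implicit Types f g : R -> R.

Lemma is_derive_mul f g (x a b : R) : is_derive x 1 f a -> is_derive x 1 g b ->
  is_derive x 1 (fun y => f y * g y) (a * g x + f x * b).
Proof.
move=> fa gb; have := is_deriveM fa gb.
by rewrite /GRing.scale /= addrC [g x * a]mulrC.
Qed.

Lemma is_derive_add f g (x a b : R) : is_derive x 1 f a -> is_derive x 1 g b ->
  is_derive x 1 (fun y => f y + g y) (a + b).
Proof. by move=> fa gb; exact: is_deriveD. Qed.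

Lemma is_derive_const (c x : R) : is_derive x 1 (fun=> c) 0.
Proof. exact: is_derive_cst. Qed.

Lemma is_derive_sinM (t x : R) :
  is_derive x 1 (fun y : R => sin (y * t)) (t * cos (x * t)).
Proof.
have d : is_derive x 1 (fun y : R => y * t) t.
  have := is_derive_mul (is_derive_id x 1) (is_derive_cst t x 1).
  by rewrite mul1r mulr0 addr0.
have := @is_derive1_comp _ sin (fun y : R => y * t) x _ _ (is_derive_sin _) d.
by rewrite mulrC.
Qed.

Lemma is_derive_cosM (t x : R) :
  is_derive x 1 (fun y : R => cos (y * t)) (- (t * sin (x * t))).
Proof.
have d : is_derive x 1 (fun y : R => y * t) t.
  have := is_derive_mul (is_derive_id x 1) (is_derive_cst t x 1).
  by rewrite mul1r mulr0 addr0.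
have := @is_derive1_comp _ cos (fun y : R => y * t) x _ _ (is_derive_cos _) d.
by rewrite mulNr mulrC.
Qed.

(** Class C^n on the whole line; the derivatives are existential data so that
    closure under products and inverses is a plain induction. *)
Fixpoint Cn (n : nat) f : Prop :=
  if n is n'.+1 then exists2 f' : R -> R, (forall x : R, is_derive x 1 f (f' x)) & Cn n' f'
  else continuous f.

Lemma is_derive_continuous f f' :
  (forall x : R, is_derive x 1 f (f' x)) -> continuous f.
Proof.
move=> df x; apply/differentiable_continuous/derivable1_diffP.
by have [] := df x.
Qed.

Lemma Cn_continuous n f : Cn n f -> continuous f.
Proof. by case: n => [//|n] [f' df _]; exact: is_derive_continuous df. Qed.

Lemma CnW n f : Cn n.+1 f -> Cn n f.
Proof.
elim: n f => [|n IHn] f; first exact: Cn_continuous.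
by move=> [f' df Cf']; exists f' => //; exact: IHn.
Qed.

Lemma Cn_add n f g : Cn n f -> Cn n g -> Cn n (fun x => f x + g x).
Proof.
elim: n f g => [|n IHn] f g /=; first by move=> cf cg x; apply: continuousD; [exact: cf|exact: cg].
move=> [f' df Cf] [g' dg Cg]; exists (fun x => f' x + g' x); last exact: IHn.
by move=> x; exact: is_derive_add.
Qed.

Lemma Cn_mul n f g : Cn n f -> Cn n g -> Cn n (fun x => f x * g x).
Proof.
elim: n f g => [|n IHn] f g; first by move=> cf cg x; apply: continuousM; [exact: cf|exact: cg].
move=> Cf Cg; have [Cf0 Cg0] := (CnW Cf, CnW Cg).
case: Cf Cg => [f' df Cf] [g' dg Cg].
exists (fun x => f' x * g x + f x * g' x).
  by move=> x; exact: is_derive_mul.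
by apply: Cn_add; exact: IHn.
Qed.

Lemma Cn_cst n (c : R) : Cn n (fun=> c).
Proof.
elim: n c => [|n IHn] c; first by move=> x; exact: cvg_cst.
by exists (fun=> 0) => // x; exact: is_derive_cst.
Qed.

Lemma Cn_id n : Cn n (fun x => x).
Proof.
case: n => [|n]; first by move=> x; exact: cvg_id.
by exists (fun=> 1); [move=> x; exact: is_derive_id|exact: Cn_cst].
Qed.

Lemma continuous_normr f : continuous f -> continuous (fun x => `|f x|).
Proof.
by move=> cf x; apply: continuous_comp; [exact: cf|exact: norm_continuous].
Qed.

Lemma Cn_inv n f : (forall x, f x != 0) -> Cn n f -> Cn n (fun x => (f x)^-1).
Proof.
move=> f0; elim: n f f0 => [|n IHn] f f0; first by move=> cf x; apply: continuousV => //; exact: cf.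
move=> Cf; have Cf0 := CnW Cf.
case: Cf => [f' df Cf]; exists (fun x => -1 * (f' x * ((f x)^-1 * (f x)^-1))).
  move=> x; have := is_deriveV (f0 x) (df x).
  rewrite /GRing.scale/= => /is_derive_eq; apply; rewrite expr2 invfM; ring.
apply: Cn_mul; first exact: Cn_cst.
by apply: Cn_mul => //; apply: Cn_mul; exact: IHn.
Qed.

End smoothness.

Section oscillatory.
Context (R : realType).
Notation leb := (@lebesgue_measure R).
Variable l : R.
Hypothesis l0 : 0 < l.

Definition trig_integral (q1 q2 : R -> R) (t : R) :=
  \int[leb]_(x in `[0, l]) (q1 x * cos (x * t) + q2 x * sin (x * t)).

Lemma continuous_integrable_segment (f : R -> R) : continuous f ->
  leb.-integrable `[0, l] (EFin \o f).
Proof.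
move=> cf; apply: continuous_compact_integrable; first exact: segment_compact.
exact: continuous_subspaceT.
Qed.

Lemma continuous_trig (q1 q2 : R -> R) t : continuous q1 -> continuous q2 ->
  continuous (fun x : R => q1 x * cos (x * t) + q2 x * sin (x * t)).
Proof.
move=> c1 c2.
have ccos : continuous (fun x : R => cos (x * t)).
  by apply: is_derive_continuous => x; exact: is_derive_cosM.
have csin : continuous (fun x : R => sin (x * t)).
  by apply: is_derive_continuous => x; exact: is_derive_sinM.
by apply: (@Cn_add _ 0); apply: (@Cn_mul _ 0).
Qed.

Lemma trig_le (a b x : R) : `|a * cos x + b * sin x| <= `|a| + `|b|.
Proof.
rewrite (le_trans (ler_normD _ _))// !normrM lerD//.
  by rewrite ler_piMr// ler_norml cos_geN1 cos_le1.
by rewrite ler_piMr// ler_norml sin_geN1 sin_le1.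
Qed.

Lemma trig_integral_le (q1 q2 : R -> R) t : continuous q1 -> continuous q2 ->
  `|trig_integral q1 q2 t| <= \int[leb]_(x in `[0, l]) (`|q1 x| + `|q2 x|).
Proof.
move=> c1 c2; have ct := @continuous_trig q1 q2 t c1 c2.
have cn : continuous (fun x : R => `|q1 x| + `|q2 x|).
  by apply: (@Cn_add _ 0); exact: continuous_normr.
apply: le_trans (le_normr_Rintegral _ _) _ => //.
  exact: continuous_integrable_segment.
apply: le_Rintegral => //.
- apply: (@continuous_integrable_segment (fun x => `|q1 x * cos (x * t) + q2 x * sin (x * t)|)).
  exact: continuous_normr.
- exact: (@continuous_integrable_segment (fun x => `|q1 x| + `|q2 x|)).
- by move=> x _; exact: trig_le.
Qed.

Lemma trig_integral_continuous (q1 q2 : R -> R) : continuous q1 -> continuous q2 ->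
  continuous (trig_integral q1 q2).
Proof.
move=> c1 c2 t.
have cn : continuous (fun x : R => `|q1 x| + `|q2 x|).
  by apply: (@Cn_add _ 0); exact: continuous_normr.
have tI : t \in `](t - 1), (t + 1)[%classic.
  by rewrite inE/= in_itv/=; apply/andP; split; lra.
apply: (@continuity_under_integral _ _ _ leb
  (fun t x => q1 x * cos (x * t) + q2 x * sin (x * t)) `[0, l] _
  (t - 1) (t + 1) _ _ (fun x => `|q1 x| + `|q2 x|)) tI => //.
- by move=> u _; apply: continuous_integrable_segment; exact: continuous_trig.
- apply: aeW => x _ u _.
  have -> : (fun t => q1 x * cos (x * t) + q2 x * sin (x * t)) =
            (fun t => q1 x * cos (t * x) + q2 x * sin (t * x)).
    by apply/funext => s; rewrite mulrC [s * x]mulrC mulrC.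
  by apply: continuous_trig => y; exact: cvg_cst.
- exact: (@continuous_integrable_segment (fun x => `|q1 x| + `|q2 x|)).
- by move=> u _; apply: aeW => x _; exact: trig_le.
Qed.

(** Two integrations by parts at once: the bracket [F] of the proof is an
    antiderivative of [t ^+ 2] times the integrand plus the same integrand for
    the second derivatives. The boundary terms carrying a factor [t] vanish by
    the three conditions on [q1] and [q2] at the endpoints; those without it are
    bounded in [t]. *)
Lemma trig_integral_by_parts (q1 q1' q1'' q2 q2' q2'' : R -> R) t :
  (forall x : R, is_derive x 1 q1 (q1' x)) -> (forall x : R, is_derive x 1 q1' (q1'' x)) ->
  (forall x : R, is_derive x 1 q2 (q2' x)) -> (forall x : R, is_derive x 1 q2' (q2'' x)) ->
  continuous q1'' -> continuous q2'' ->
  q1 l = 0 -> q2 l = 0 -> q2 0 = 0 ->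
  t ^+ 2 * trig_integral q1 q2 t =
  q1' l * cos (l * t) + q2' l * sin (l * t) - q1' 0 - trig_integral q1'' q2'' t.
Proof.
move=> d1 d1' d2 d2' c1 c2 q1l q2l q20.
pose F x := t * (q1 x * sin (x * t) + -1 * (q2 x * cos (x * t))) +
  (q1' x * cos (x * t) + q2' x * sin (x * t)).
pose f x := t ^+ 2 * (q1 x * cos (x * t) + q2 x * sin (x * t)) +
  (q1'' x * cos (x * t) + q2'' x * sin (x * t)).
have dF (x : R) : is_derive x 1 F (f x).
  have h := is_derive_add
    (is_derive_mul (is_derive_const t x) (is_derive_add
      (is_derive_mul (d1 x) (is_derive_sinM t x))
      (is_derive_mul (is_derive_const (-1) x)
         (is_derive_mul (d2 x) (is_derive_cosM t x)))))
    (is_derive_add (is_derive_mul (d1' x) (is_derive_cosM t x))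
                   (is_derive_mul (d2' x) (is_derive_sinM t x))).
  refine (is_derive_eq h _).
  by rewrite /f; ring.
have cq1 := is_derive_continuous d1.
have cq2 := is_derive_continuous d2.
have ct0 := @continuous_trig _ _ t cq1 cq2.
have ct2 := @continuous_trig _ _ t c1 c2.
have cf : continuous f.
  by apply: (@Cn_add _ 0) => //; apply: (@Cn_mul _ 0) => //; exact: (@Cn_cst _ 0).
have cF : continuous F by exact: is_derive_continuous dF.
have /(congr1 fine) /= : (\int[leb]_(x in `[0%R, l]) (f x)%:E = (F l)%:E - (F 0)%:E)%E.
  apply: continuous_FTC2 => //.
  - exact: continuous_subspaceT.
  - split.
    + by move=> x _; have [] := dF x.
    + by apply: cvg_at_right_filter; exact: cF.
    + by apply: cvg_at_left_filter; exact: cF.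
  - by move=> x _; rewrite derive1E; have [_ ->] := dF x.
rewrite -/(Rintegral leb `[0, l] f) RintegralD//; last 2 first.
  by apply: (@continuous_integrable_segment (fun x => t ^+ 2 * _)) ;
    apply: (@Cn_mul _ 0) => //; exact: (@Cn_cst _ 0).
  exact: continuous_integrable_segment.
rewrite RintegralZl//; last exact: continuous_integrable_segment.
rewrite -/(trig_integral q1 q2 t) -/(trig_integral q1'' q2'' t) /F q1l q2l q20 !mul0r sin0 cos0.
lra.
Qed.

(** The decay in 1 / t^2 that makes the transform of a compactly supported
    function integrable. *)
Lemma trig_integral_decay (q1 q2 : R -> R) :
  Cn 2 q1 -> Cn 2 q2 -> q1 l = 0 -> q2 l = 0 -> q2 0 = 0 ->
  exists C, forall t, `|trig_integral q1 q2 t| * (1 + t ^+ 2) <= C.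
Proof.
move=> Cq1 Cq2 q1l q2l q20.
have [c1 c2] := (Cn_continuous Cq1, Cn_continuous Cq2).
case: Cq1 Cq2 => [q1' d1 [q1'' d1' c1'']] [q2' d2 [q2'' d2' c2'']].
exists (\int[leb]_(x in `[0, l]) (`|q1 x| + `|q2 x|) +
  (`|q1' l| + `|q2' l| + `|q1' 0| +
   \int[leb]_(x in `[0, l]) (`|q1'' x| + `|q2'' x|))) => t.
rewrite mulrDr mulr1 lerD//; first exact: trig_integral_le.
rewrite mulrC -{1}[t ^+ 2]ger0_norm ?sqr_ge0// -normrM.
rewrite (trig_integral_by_parts _ d1 d1' d2 d2')//.
rewrite (le_trans (ler_normB _ _))// lerD//; last exact: trig_integral_le.
by rewrite (le_trans (ler_normB _ _))// lerD2r trig_le.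
Qed.

Lemma integrable_inv_oneDsqr :
  leb.-integrable setT (fun t => ((1 + t ^+ 2)^-1)%:E).
Proof.
have c : continuous (fun t : R => (1 + t ^+ 2)^-1) by exact: continuous_oneDsqrV.
apply/integrableP; split.
  by apply/measurable_EFinP; exact: continuous_measurable_fun.
under eq_integral do rewrite gee0_abs ?lee_fin ?invr_ge0 ?addr_ge0 ?sqr_ge0//.
rewrite ge0_symfun_integralT//=.
- by rewrite -set_itvcy (integral0y_oneDsqr R) ltry.
- by move=> x; rewrite invr_ge0 addr_ge0 ?sqr_ge0.
- by move=> x /=; rewrite sqrrN.
Qed.

Lemma integrable_quadratic_decay (K : R -> R) C : continuous K ->
  (forall t, `|K t| * (1 + t ^+ 2) <= C) -> leb.-integrable setT (EFin \o K).
Proof.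
move=> cK KC.
have mK : measurable_fun (setT : set (measurableTypeR R)) K.
  exact: continuous_measurable_fun.
have ig : leb.-integrable setT (EFin \o (fun t : R => C * (1 + t ^+ 2)^-1)).
  exact: (@integrableZl _ _ _ leb setT measurableT C (fun t => ((1 + t ^+ 2)^-1)%:E)
    integrable_inv_oneDsqr).
refine (integrable_dominated mK ig _) => t.
by rewrite ler_pdivlMr// ltr_wpDr ?sqr_ge0.
Qed.

End oscillatory.

(** * Cosine and sine transforms of a weighted law *)

Section trig_transform.
Context d (T : measurableType d) (R : realType).
Variables (mu : {measure set T -> \bar R}) (S : T -> R).
Hypothesis mS : measurable_fun setT S.

Definition cos_transform (f : T -> R) (x : R) := \int[mu]_w (f w * cos (x * S w)).
Definition sin_transform (f : T -> R) (x : R) := \int[mu]_w (f w * sin (x * S w)).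

(** Integrability of [f] against all powers of [S], the condition under which the
    transforms may be differentiated any number of times. *)
Definition all_moments (f : T -> R) := measurable_fun setT f /\
  forall k, mu.-integrable setT (fun w => (f w * S w ^+ k)%:E).

Lemma all_momentsM f : all_moments f -> all_moments (fun w => f w * S w).
Proof.
move=> [mf intf]; split; first exact: measurable_funM.
move=> k; have := intf k.+1.
by under eq_fun do rewrite exprS mulrA.
Qed.

Lemma all_moments_integrable f : all_moments f ->
  mu.-integrable setT (EFin \o f).
Proof. by move=> [_ /(_ 0)]; under eq_fun do rewrite expr0 mulr1. Qed.

Lemma measurable_cosS (x : R) : measurable_fun setT (fun w => cos (x * S w)).
Proof.
apply: measurableT_comp; last exact: measurable_funM.
exact: continuous_measurable_fun (@continuous_cos R).
Qed.

Lemma measurable_sinS (x : R) : measurable_fun setT (fun w => sin (x * S w)).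
Proof.
apply: measurableT_comp; last exact: measurable_funM.
exact: continuous_measurable_fun (@continuous_sin R).
Qed.

Lemma integrable_cosS f (x : R) : mu.-integrable setT (EFin \o f) ->
  mu.-integrable setT (EFin \o (fun w => f w * cos (x * S w))).
Proof.
move=> fi; have mf : measurable_fun setT f by have /measurable_int/measurable_EFinP := fi.
apply: integrable_dominated (integrable_normr fi) _.
  by apply: measurable_funM => //; exact: measurable_cosS.
by move=> w; rewrite normrM ler_piMr// ler_norml cos_geN1 cos_le1.
Qed.

Lemma integrable_sinS f (x : R) : mu.-integrable setT (EFin \o f) ->
  mu.-integrable setT (EFin \o (fun w => f w * sin (x * S w))).
Proof.
move=> fi; have mf : measurable_fun setT f by have /measurable_int/measurable_EFinP := fi.
apply: integrable_dominated (integrable_normr fi) _.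
  by apply: measurable_funM => //; exact: measurable_sinS.
by move=> w; rewrite normrM ler_piMr// ler_norml sin_geN1 sin_le1.
Qed.

Lemma is_derive_under_integral (f g : R -> T -> R) (G : T -> R) (a : R) :
  (forall x, mu.-integrable setT (EFin \o f x)) ->
  (forall (x : R) w, is_derive x 1 (f ^~ w) (g x w)) ->
  mu.-integrable setT (EFin \o G) -> (forall x w, `|g x w| <= G w) ->
  is_derive a 1 (fun x => \int[mu]_w f x w) (\int[mu]_w g a w).
Proof.
move=> fi fg Gi gG.
have Ia : `](a - 1), (a + 1)[%classic a by rewrite /= in_itv/=; apply/andP; split; lra.
have pE x w : partial1of2 f x w = g x w.
  by rewrite partial1of2E; have [_ ->] := fg x w.
have G0 w : 0 <= G w by rewrite (le_trans _ (gG a w)).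
have H1 x y : `](a - 1), (a + 1)[%classic x -> setT y -> derivable (f^~ y) x 1.
  by move=> _ _; have [] := fg x y.
have H2 x y : `](a - 1), (a + 1)[%classic x -> setT y -> `|partial1of2 f x y| <= G y.
  by move=> _ _; rewrite pE.
apply: DeriveDef.
  exact: (@derivable_under_integral _ _ _ mu f setT measurableT a (a - 1) (a + 1)
    Ia (fun x _ => fi x) H1 G G0 Gi H2).
rewrite -derive1E (@differentiation_under_integral _ _ _ mu f setT measurableT a (a - 1) (a + 1)
    Ia (fun x _ => fi x) H1 G G0 Gi H2).
by apply: eq_Rintegral => w _; rewrite pE.
Qed.

Lemma is_derive_cos_transform f (x : R) : all_moments f ->
  is_derive x 1 (cos_transform f) (-1 * sin_transform (fun w => f w * S w) x).
Proof.
move=> Mf; have fi := all_moments_integrable Mf.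
have fSi := all_moments_integrable (all_momentsM Mf).
have -> : -1 * sin_transform (fun w => f w * S w) x = \int[mu]_w (f w * - (S w * sin (x * S w))).
  rewrite -RintegralZl//; last exact: integrable_sinS.
  by apply: eq_Rintegral => w _; ring.
apply: (@is_derive_under_integral (fun x w => f w * cos (x * S w))
  (fun x w => f w * - (S w * sin (x * S w))) (fun w => `|f w * S w|)).
- by move=> y; exact: integrable_cosS.
- move=> y w; have := is_derive_mul (is_derive_const (f w) y) (is_derive_cosM (S w) y).
  by rewrite mul0r add0r.
- exact: integrable_normr.
- move=> y w; rewrite mulrN normrN mulrA normrM ler_piMr//.
  by rewrite ler_norml sin_geN1 sin_le1.
Qed.

Lemma is_derive_sin_transform f (x : R) : all_moments f ->
  is_derive x 1 (sin_transform f) (cos_transform (fun w => f w * S w) x).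
Proof.
move=> Mf; have fi := all_moments_integrable Mf.
have fSi := all_moments_integrable (all_momentsM Mf).
have -> : cos_transform (fun w => f w * S w) x = \int[mu]_w (f w * (S w * cos (x * S w))).
  by apply: eq_Rintegral => w _; rewrite mulrA.
apply: (@is_derive_under_integral (fun x w => f w * sin (x * S w))
  (fun x w => f w * (S w * cos (x * S w))) (fun w => `|f w * S w|)).
- by move=> y; exact: integrable_sinS.
- move=> y w; have := is_derive_mul (is_derive_const (f w) y) (is_derive_sinM (S w) y).
  by rewrite mul0r add0r.
- exact: integrable_normr.
- move=> y w; rewrite mulrA normrM ler_piMr//.
  by rewrite ler_norml cos_geN1 cos_le1.
Qed.

Lemma Cn_transforms n f : all_moments f -> Cn n (cos_transform f) /\ Cn n (sin_transform f).
Proof.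
elim: n f => [|n IHn] f Mf.
  split; last by apply: is_derive_continuous => x; exact: is_derive_sin_transform.
  by apply: is_derive_continuous => x; exact: is_derive_cos_transform.
have [Cc Cs] := IHn _ (all_momentsM Mf).
split.
  exists (fun x => -1 * sin_transform (fun w => f w * S w) x).
    by move=> x; exact: is_derive_cos_transform.
  by apply: Cn_mul => //; exact: Cn_cst.
exists (cos_transform (fun w => f w * S w)) => // x; exact: is_derive_sin_transform.
Qed.

Lemma sin_transform0 f : sin_transform f 0 = 0.
Proof.
rewrite /sin_transform; under eq_Rintegral do rewrite mul0r sin0 mulr0.
by rewrite /Rintegral integral0.
Qed.

Lemma cos_transform0 f : cos_transform f 0 = \int[mu]_w f w.
Proof. by apply: eq_Rintegral => w _; rewrite mul0r cos0 mulr1. Qed.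

Lemma cos_transformN f x : cos_transform f (- x) = cos_transform f x.
Proof. by apply: eq_Rintegral => w _; rewrite mulNr cosN. Qed.

Lemma sin_transformN f (x : R) : mu.-integrable setT (EFin \o f) -> sin_transform f (- x) = - sin_transform f x.
Proof.
move=> fi; rewrite -[RHS]mulN1r /sin_transform -RintegralZl//; last exact: integrable_sinS.
by apply: eq_Rintegral => w _; rewrite mulNr sinN mulrN mulN1r.
Qed.

End trig_transform.

(** * Fubini, the Fejer kernel, and division by the transform *)

Section fubini_real.
Context d1 d2 (T1 : measurableType d1) (T2 : measurableType d2) (R : realType).
Variable m1 : {sigma_finite_measure set T1 -> \bar R}.
Variable m2 : {sigma_finite_measure set T2 -> \bar R}.

Lemma integrable_prod_section (f : T1 * T2 -> R) (g : T1 -> R) :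
  measurable_fun setT f ->
  (forall x, \int[m2]_y `|(f (x, y))%:E| <= (g x)%:E)%E ->
  m1.-integrable setT (EFin \o g) -> (m1 \x m2)%E.-integrable setT (EFin \o f).
Proof.
move=> mf fg gi; apply/integrable12ltyP; first exact/measurable_EFinP.
have /integrableP[mg] := gi; apply: le_lt_trans.
apply: ge0_le_integral => //.
- by move=> x _; exact: integral_ge0.
- apply: (measurable_fun_fubini_tonelli_F (fun z => `|(EFin \o f) z|%E)) => //.
  by apply: measurableT_comp => //; exact/measurable_EFinP.
- by apply: measurableT_comp.
- by move=> x _; rewrite (le_trans (fg x))//= lee_fin ler_norm.
Qed.

(** The inner integrals are real-valued, so finiteness is required of every
    section, not only of almost every one. *)
Lemma Rfubini (f : T1 * T2 -> R) :
  (m1 \x m2)%E.-integrable setT (EFin \o f) ->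
  (forall x, m2.-integrable setT (fun y => (f (x, y))%:E)) ->
  (forall y, m1.-integrable setT (fun x => (f (x, y))%:E)) ->
  \int[m1]_x \int[m2]_y f (x, y) = \int[m2]_y \int[m1]_x f (x, y).
Proof.
move=> fi fi2 fi1; congr fine.
under eq_integral => x _ do rewrite fineK ?integrable_fin_num//.
under [RHS]eq_integral => y _ do rewrite fineK ?integrable_fin_num//.
exact: (@Fubini _ _ _ _ _ m1 m2 (EFin \o f)).
Qed.

End fubini_real.

Section fejer.
Context (R : realType).
Notation leb := (@lebesgue_measure R).

(** The Fejer kernel (1 - cos(l t)) / t^2, introduced as the transform of a
    triangle: this form makes it divisible by another transform. *)
Definition fejer (l t : R) := trig_integral l (fun x => l - x) (fun=> 0) t.

Lemma is_derive_subl (l x : R) : is_derive x 1 (fun y => l - y) (-1).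
Proof.
have := is_derive_add (is_derive_const l x)
  (is_derive_mul (is_derive_const (-1) x) (is_derive_id x 1)).
rewrite mul0r add0r add0r mulr1.
by under eq_fun do rewrite mulN1r.
Qed.

Lemma Cn_subl n (l : R) : Cn n (fun x => l - x).
Proof.
case: n => [|n]; first exact: is_derive_continuous (is_derive_subl l).
by exists (fun=> -1); [exact: is_derive_subl|exact: Cn_cst].
Qed.

Variable l : R.
Hypothesis l0 : 0 < l.

(** The kernel is itself an oscillatory integral, with an affine amplitude, so its
    closed form is the integration by parts without a remainder. *)
Lemma fejerE t : t ^+ 2 * fejer l t = 1 - cos (l * t).
Proof.
rewrite (trig_integral_by_parts l0 t (is_derive_subl l) (is_derive_const (-1))
  (is_derive_const 0) (is_derive_const 0)) ?subrr//; last 2 first.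
- by move=> x; exact: cvg_cst.
- by move=> x; exact: cvg_cst.
rewrite [X in _ - X](_ : _ = 0); last first.
  rewrite /trig_integral; under eq_Rintegral do rewrite !mul0r addr0.
  by rewrite /Rintegral integral0.
lra.
Qed.

Lemma fejer_ge0 t : 0 <= fejer l t.
Proof.
have [->|t0] := eqVneq t 0.
  apply: Rintegral_ge0 => x /=; rewrite in_itv/= => /andP[_ xl].
  by rewrite mulr0 cos0 mul0r addr0 mulr1 subr_ge0.
have : 0 <= t ^+ 2 * fejer l t by rewrite fejerE subr_ge0 cos_le1.
by rewrite pmulr_rge0// exprn_even_gt0.
Qed.

Lemma fejer_le t : t ^+ 2 * fejer l t <= 2.
Proof. by rewrite fejerE; have := cos_geN1 (l * t); lra. Qed.

Lemma fejer_continuous : continuous (fejer l).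
Proof.
apply: trig_integral_continuous => //; last by move=> x; exact: cvg_cst.
exact: (@Cn_subl 0).
Qed.

Lemma integrable_fejer : leb.-integrable setT (EFin \o fejer l).
Proof.
have [|||||C hC] := @trig_integral_decay _ _ l0 (fun x => l - x) (fun=> 0).
- exact: Cn_subl.
- exact: Cn_cst.
- exact: subrr.
- by [].
- by [].
exact: integrable_quadratic_decay fejer_continuous hC.
Qed.

Lemma cos_ge_half (x : R) : `|x| <= 2^-1 -> 2^-1 <= cos x.
Proof.
have pos (y : R) : 0 < y -> `|y| <= 2^-1 -> 2^-1 <= cos y.
  move=> y0 yh.
  have dc (z : R) : z \in `]0, y[ -> is_derive z 1 cos (- sin z) by move=> _; exact: is_derive_cos.
  have cc : {within `[0, y], continuous (@cos R)} by apply: continuous_subspaceT; exact: continuous_cos.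
  have [c _] := MVT y0 dc cc.
  rewrite cos0 subr0 => cE.
  have : sin c * y <= 2^-1.
    rewrite (le_trans (ler_norm _))// normrM (le_trans _ yh)// ler_piMl//.
    by rewrite ler_norml sin_geN1 sin_le1.
  lra.
move=> xh; have [x0|x0|->] := ltgtP x 0.
- by rewrite -cosN pos ?normrN// oppr_gt0.
- exact: pos.
- by rewrite cos0; lra.
Qed.

(** With the bound [2 / t ^+ 2] away from 0, this makes the kernels concentrate at 0:
    the mass near 0 grows like [l] while the mass elsewhere stays bounded. *)
Lemma fejer_ge t : `|t| <= (2 * l)^-1 -> l ^+ 2 / 4 <= fejer l t.
Proof.
move=> tl.
have cl : continuous (fun x : R => 2^-1 * (l - x)).
  by apply: (@Cn_mul _ 0); [exact: Cn_cst|exact: Cn_subl].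
have -> : l ^+ 2 / 4 = \int[leb]_(x in `[0, l]) (2^-1 * (l - x)).
  pose F x := 4^-1 * (-1 * ((l - x) * (l - x))).
  have dF (x : R) : is_derive x 1 F (2^-1 * (l - x)).
    apply: is_derive_eq (is_derive_mul (is_derive_const 4^-1 x)
       (is_derive_mul (is_derive_const (-1) x)
      (is_derive_mul (is_derive_subl l x) (is_derive_subl l x)))) _.
    lra.
  have cF := is_derive_continuous dF.
  have -> : \int[leb]_(x in `[0, l]) (2^-1 * (l - x)) = F l - F 0.
    rewrite /Rintegral (continuous_FTC2 l0 (F := F))//.
    - exact: continuous_subspaceT.
    - split.
      + by move=> x _; have [] := dF x.
      + by apply: cvg_at_right_filter; exact: cF.
      + by apply: cvg_at_left_filter; exact: cF.
    - by move=> x _; rewrite derive1E; have [_ ->] := dF x.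
  by rewrite /F; field.
apply: le_Rintegral => //.
- exact: continuous_integrable_segment.
- apply: continuous_integrable_segment; apply: continuous_trig.
    exact: (@Cn_subl 0).
  exact: (@Cn_cst _ 0).
- move=> x; rewrite /= in_itv/= => /andP[x0 xl].
  rewrite mul0r addr0 mulrC ler_wpM2l ?subr_ge0// cos_ge_half// normrM.
  rewrite (ger0_norm x0) (le_trans (ler_wpM2l x0 tl))//.
  by rewrite invfM mulrCA -ler_pdivlMl ?invr_gt0// invrK divff// ler_pdivrMr// mul1r.
Qed.

End fejer.

Section division.
Context d (T : measurableType d) (R : realType).
Notation leb := (@lebesgue_measure R).
Variables (P : {sigma_finite_measure set T -> \bar R}) (W S : T -> R).
Hypothesis mS : measurable_fun setT S.
Hypothesis W0 : forall w, 0 <= W w.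
Hypothesis MW : all_moments P S W.
Hypothesis nz : forall x, cos_transform P S W x ^+ 2 + sin_transform P S W x ^+ 2 != 0.

Let D x := cos_transform P S W x ^+ 2 + sin_transform P S W x ^+ 2.
Let q1 l x := (l - x) * (cos_transform P S W x * (D x)^-1).
Let q2 l x := (l - x) * (sin_transform P S W x * (D x)^-1).

Let CnD n : Cn n D.
Proof.
by have [? ?] := Cn_transforms mS n MW; apply: Cn_add; apply: Cn_mul.
Qed.

Let Cnq1 n l : Cn n (q1 l).
Proof.
have [? ?] := Cn_transforms mS n MW; apply: Cn_mul; first exact: Cn_subl.
by apply: Cn_mul => //; exact: Cn_inv.
Qed.

Let Cnq2 n l : Cn n (q2 l).
Proof.
have [? ?] := Cn_transforms mS n MW; apply: Cn_mul; first exact: Cn_subl.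
by apply: Cn_mul => //; exact: Cn_inv.
Qed.

(** Division of the Fejer kernel by the transform k = A + i B, which is where the
    absence of zeros enters. The function psi is the cosine-sine integral of the
    triangle times the real and imaginary parts of 1 / k, namely A / (A^2 + B^2)
    and B / (A^2 + B^2) up to sign; expanding cos and sin of x (t + S) and
    exchanging expectation and integral recombines A and B into A^2 + B^2. The
    triangle vanishes at [l] and B vanishes at 0, which are the boundary
    conditions of [trig_integral_decay]. *)
Lemma fejer_division l : 0 < l ->
  exists psi : R -> R, [/\ continuous psi,
    exists C, forall t, `|psi t| <= C,
    leb.-integrable setT (EFin \o psi) &
    forall t, \int[P]_w (W w * psi (t + S w)) = fejer l t].
Proof.
move=> l0; pose psi := trig_integral l (q1 l) (q2 l).
have c1 := Cn_continuous (Cnq1 0 l).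
have c2 := Cn_continuous (Cnq2 0 l).
have cpsi : continuous psi by exact: trig_integral_continuous.
have [C hC] : exists C, forall t, `|psi t| * (1 + t ^+ 2) <= C.
  apply: trig_integral_decay => //.
  - by rewrite /q1 subrr mul0r.
  - by rewrite /q2 subrr mul0r.
  - by rewrite /q2 sin_transform0 mul0r mulr0.
exists psi; split => //.
- exists C => t; apply: le_trans (hC t).
  by rewrite ler_peMr// lerDl sqr_ge0.
- exact: integrable_quadratic_decay cpsi hC.
move=> t; have Wi := all_moments_integrable MW.
have [mW _] := MW.
pose I : R -> R := \1_(`[0, l] : set R).
pose f (z : T * measurableTypeR R) :=
  W z.1 * ((q1 l z.2 * cos (z.2 * (t + S z.1)) + q2 l z.2 * sin (z.2 * (t + S z.1))) * I z.2).
pose Q x := `|q1 l x| + `|q2 l x|.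
have cQ : continuous Q by apply: (@Cn_add _ 0); exact: continuous_normr.
have patchI (h : R -> R) : (fun x => h x * I x) = h \_ `[0, l].
  by rewrite patch_indic.
have segI (h : R -> R) : continuous h ->
    leb.-integrable setT (EFin \o (fun x => h x * I x)).
  move=> ch; rewrite patchI -restrict_EFin.
  by apply/(integrable_mkcond _ _).1 => //; exact: continuous_integrable_segment.
have I01 x : 0 <= I x <= 1 by rewrite /I indicE; case: (_ \in _); rewrite /= ler01 lexx.
have fQ w x : `|f (w, x)| <= W w * (Q x * I x).
  rewrite /f/= !normrM (ger0_norm (W0 w)) ler_wpM2l// (ger0_norm (proj1 (andP (I01 x)))).
  by rewrite ler_wpM2r ?(proj1 (andP (I01 x)))// trig_le.
have mI : measurable_fun (setT : set (measurableTypeR R)) I by exact: measurable_indic.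
have mc1 : measurable_fun (setT : set (measurableTypeR R)) (q1 l).
  exact: continuous_measurable_fun.
have mc2 : measurable_fun (setT : set (measurableTypeR R)) (q2 l).
  exact: continuous_measurable_fun.
have msnd h : measurable_fun (setT : set (measurableTypeR R)) h ->
    measurable_fun setT (fun z : T * measurableTypeR R => h z.2 : R).
  by move=> mh; exact: measurableT_comp mh measurable_snd.
have marg : measurable_fun setT (fun z : T * measurableTypeR R => z.2 * (t + S z.1)).
  apply: measurable_funM; first exact: measurable_snd.
  by apply: measurable_funD => //; exact: measurableT_comp mS measurable_fst.
have mf : measurable_fun setT f.
  apply: measurable_funM; first exact: measurableT_comp mW measurable_fst.
  apply: measurable_funM; last exact: msnd.
  apply: measurable_funD; apply: measurable_funM; try exact: msnd.
    by apply: measurableT_comp marg; exact: continuous_measurable_fun (@continuous_cos R).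
  by apply: measurableT_comp marg; exact: continuous_measurable_fun (@continuous_sin R).
have QIi := segI Q cQ.
have fi2 w : leb.-integrable setT (fun x => (f (w, x))%:E).
  rewrite (_ : (fun x => _) = EFin \o (fun x => f (w, x)))//.
  apply: (integrable_dominated _ _ (fQ w)).
    exact: measurableT_comp mf (measurable_pair1 w).
  exact: integrableRZl.
have fi1 x : P.-integrable setT (fun w => (f (w, x))%:E).
  rewrite (_ : (fun w => _) = EFin \o (fun w => f (w, x)))//.
  apply: (@integrable_dominated _ _ _ _ _ (fun w => W w * (Q x * I x)) _ _ (fQ ^~ x)).
    exact: measurableT_comp mf (measurable_pair2 x).
  exact: integrableRZr.
have fi : (P \x leb)%E.-integrable setT (EFin \o f).
  apply: (@integrable_prod_section _ _ _ _ _ _ _ _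
    (fun w => W w * \int[leb]_x (Q x * I x))) => //.
    move=> w.
    have -> : (W w * \int[leb]_x (Q x * I x))%:E = (\int[leb]_x (W w * (Q x * I x))%:E)%E.
      rewrite EFinM fineK ?integrable_fin_num//.
      by under [RHS]eq_integral do rewrite EFinM; rewrite integralZl.
    apply: ge0_le_integral => //.
    - by have /measurable_int := fi2 w; exact: measurableT_comp.
    - apply/measurable_EFinP; apply: measurable_funM => //.
      by have /measurable_int/measurable_EFinP := QIi.
    - by move=> x _; rewrite lee_fin fQ.
  exact: integrableRZr.
transitivity (\int[P]_w \int[leb]_x f (w, x)).
  apply: eq_Rintegral => w _.
  rewrite /psi /trig_integral Rintegral_mkcond -patchI -RintegralZl//.
  exact/segI/continuous_trig.
rewrite (Rfubini fi fi2 fi1) /fejer /trig_integral [RHS]Rintegral_mkcond -patchI.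
apply: eq_Rintegral => x _; rewrite /f/=.
transitivity (\int[P]_w ((q1 l x * cos (x * t) + q2 l x * sin (x * t)) * I x * (W w * cos (x * S w)) +
   (q2 l x * cos (x * t) - q1 l x * sin (x * t)) * I x * (W w * sin (x * S w)))).
  by apply: eq_Rintegral => w _; rewrite mulrDr cosD sinD; ring.
have ci := integrable_cosS mS x Wi.
have si := integrable_sinS mS x Wi.
rewrite RintegralD//; last 2 first.
- exact: integrableRZl.
- exact: integrableRZl.
rewrite !RintegralZl// -/(cos_transform P S W x) -/(sin_transform P S W x) /q1 /q2 mul0r addr0.
have Dx := nz x; rewrite -/(D x) in Dx.
have e : cos_transform P S W x ^+ 2 + sin_transform P S W x ^+ 2 = D x by [].
transitivity ((l - x) * cos (x * t) * I x * ((cos_transform P S W x ^+ 2 + sin_transform P S W x ^+ 2) / D x)).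
  by ring.
by rewrite e divff// mulr1.
Qed.

End division.

(** * Convolution with the weighted law *)

Section convolution.
Context d (T : measurableType d) (R : realType).
Notation leb := (@lebesgue_measure R).
Notation mR := (measurableTypeR R).
Variables (P : {sigma_finite_measure set T -> \bar R}) (W S : T -> R).
Hypothesis mS : measurable_fun setT S.
Hypothesis mW : measurable_fun setT W.
Hypothesis W0 : forall w, 0 <= W w.
Hypothesis Wi : P.-integrable setT (EFin \o W).
Variables (psi : R -> R) (B : R).
Hypothesis cpsi : continuous psi.
Hypothesis psiB : forall t, `|psi t| <= B.
Hypothesis ipsi : leb.-integrable setT (EFin \o psi).

Let mpsi : measurable_fun (setT : set mR) psi.
Proof. exact: continuous_measurable_fun. Qed.

Section bounded_function.
Variables (f : mR -> R) (K : R).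
Hypothesis mf : measurable_fun (setT : set mR) f.
Hypothesis fK : forall s, `|f s| <= K.

Let K0 : 0 <= K. Proof. exact: le_trans (fK 0). Qed.

Let F1 (z : T * mR) : R := W z.1 * (f z.2 * psi (z.2 + S z.1)).
Let F2 (z : T * mR) : R := W z.1 * (f (z.2 - S z.1) * psi z.2).

Let margD : measurable_fun setT (fun z : T * mR => z.2 + S z.1).
Proof.
apply: measurable_funD; first exact: measurable_snd.
exact: measurableT_comp mS measurable_fst.
Qed.

Let margB : measurable_fun setT (fun z : T * mR => z.2 - S z.1).
Proof.
apply: measurable_funB; first exact: measurable_snd.
exact: measurableT_comp mS measurable_fst.
Qed.

Let mF1 : measurable_fun setT F1.
Proof.
apply: measurable_funM; first exact: measurableT_comp mW measurable_fst.
apply: measurable_funM; first exact: measurableT_comp mf measurable_snd.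
exact: measurableT_comp mpsi margD.
Qed.

Let mF2 : measurable_fun setT F2.
Proof.
apply: measurable_funM; first exact: measurableT_comp mW measurable_fst.
apply: measurable_funM; last exact: measurableT_comp mpsi measurable_snd.
exact: measurableT_comp mf margB.
Qed.

Let ipsin : leb.-integrable setT (EFin \o (fun t => `|psi t|)).
Proof. exact: integrable_normr. Qed.

Let F1_le w s : `|F1 (w, s)| <= W w * (K * `|psi (s + S w)|).
Proof. by rewrite /F1/= !normrM (ger0_norm (W0 w)) ler_wpM2l// ler_wpM2r. Qed.

Let F2_le w s : `|F2 (w, s)| <= W w * (K * `|psi s|).
Proof. by rewrite /F2/= !normrM (ger0_norm (W0 w)) ler_wpM2l// ler_wpM2r. Qed.

Let dom1 w : leb.-integrable setT (EFin \o (fun s => W w * (K * `|psi (s + S w)|))) /\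
  \int[leb]_s (W w * (K * `|psi (s + S w)|)) = W w * (K * \int[leb]_s `|psi s|).
Proof.
have [ti te] := Rintegral_translation (S w) ipsin.
have tKi : leb.-integrable setT (EFin \o (fun s => K * `|psi (s + S w)|)).
  exact: integrableRZl.
split; last by rewrite RintegralZl// RintegralZl// te.
exact: integrableRZl.
Qed.

Let dom2 w : leb.-integrable setT (EFin \o (fun s => W w * (K * `|psi s|))) /\
  \int[leb]_s (W w * (K * `|psi s|)) = W w * (K * \int[leb]_s `|psi s|).
Proof.
have tKi : leb.-integrable setT (EFin \o (fun s => K * `|psi s|)).
  exact: integrableRZl.
split; last by rewrite RintegralZl// RintegralZl.
exact: integrableRZl.
Qed.

Let prod_int (F : T * mR -> R) (g : T -> R -> R) : measurable_fun setT F ->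
  (forall w s, `|F (w, s)| <= g w s) ->
  (forall w, leb.-integrable setT (EFin \o g w) /\
    \int[leb]_s g w s = W w * (K * \int[leb]_s `|psi s|)) ->
  (P \x leb)%E.-integrable setT (EFin \o F).
Proof.
move=> mF Fg gi.
apply: (@integrable_prod_section _ _ _ _ _ _ _ _
    (fun w => W w * (K * \int[leb]_s `|psi s|))) => //; last first.
  exact: integrableRZr.
move=> w; have [gwi <-] := gi w.
rewrite fineK ?integrable_fin_num//.
apply: ge0_le_integral => //.
- by apply: measurableT_comp => //; apply/measurable_EFinP; exact: measurableT_comp mF (measurable_pair1 w).
- exact: measurable_int gwi.
- by move=> s _; rewrite lee_fin.
Qed.

Let F1i w : leb.-integrable setT (fun s => (F1 (w, s))%:E).
Proof.
rewrite (_ : (fun x => _) = EFin \o (fun x => F1 (w, x)))//.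
apply: (integrable_dominated _ (dom1 w).1 (F1_le w)).
exact: measurableT_comp mF1 (measurable_pair1 w).
Qed.

Let F2i w : leb.-integrable setT (fun s => (F2 (w, s))%:E).
Proof.
rewrite (_ : (fun x => _) = EFin \o (fun x => F2 (w, x)))//.
apply: (integrable_dominated _ (dom2 w).1 (F2_le w)).
exact: measurableT_comp mF2 (measurable_pair1 w).
Qed.

Lemma integrable_weight_bounded (h : T -> R) C : measurable_fun setT h ->
  (forall w, `|h w| <= C) -> P.-integrable setT (EFin \o (fun w => W w * h w)).
Proof.
move=> mh hC; apply: (@integrable_dominated _ _ _ _ _ (fun w => W w * C)).
- exact: measurable_funM.
- exact: integrableRZr.
- by move=> w; rewrite normrM (ger0_norm (W0 w)) ler_wpM2l.
Qed.

Let F1i' s : P.-integrable setT (fun w => (F1 (w, s))%:E).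
Proof.
apply: (@integrable_weight_bounded (fun w => f s * psi (s + S w)) (K * B)).
  apply: measurable_funM => //.
  by apply: measurableT_comp mpsi _; exact: measurable_funD.
by move=> w; rewrite normrM ler_pM.
Qed.

Let F2i' s : P.-integrable setT (fun w => (F2 (w, s))%:E).
Proof.
apply: (@integrable_weight_bounded (fun w => f (s - S w) * psi s) (K * B)).
  apply: measurable_funM => //.
  by apply: measurableT_comp mf _; exact: measurable_funB.
by move=> w; rewrite normrM ler_pM.
Qed.

Let F2E v : \int[P]_w F2 (w, v) = psi v * \int[P]_w (W w * f (v - S w)).
Proof.
rewrite -RintegralZl//.
  by apply: eq_Rintegral => w _; rewrite /F2/=; ring.
apply: (@integrable_weight_bounded (fun w => f (v - S w)) K) => //.
by apply: measurableT_comp mf _; exact: measurable_funB.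
Qed.

Lemma measurable_convolution : measurable_fun (setT : set mR)
  (fun v : mR => psi v * \int[P]_w (W w * f (v - S w)) : R).
Proof.
under eq_fun do rewrite -F2E.
apply: measurableT_comp; first exact: (@fine_measurable R setT).
exact: (measurable_fubini_G (prod_int mF2 F2_le dom2)).
Qed.

(** Moving the expectation from psi to f: Fubini, the substitution v = s + S for
    each value of S, and Fubini again. *)
Lemma convolution_identity :
  \int[leb]_s (f s * \int[P]_w (W w * psi (s + S w))) =
  \int[leb]_v (psi v * \int[P]_w (W w * f (v - S w))).
Proof.
transitivity (\int[leb]_s \int[P]_w F1 (w, s)).
  apply: eq_Rintegral => s _; rewrite -RintegralZl//.
    by apply: eq_Rintegral => w _; rewrite /F1/=; ring.
  apply: (@integrable_weight_bounded (fun w => psi (s + S w)) B) => //.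
  by apply: measurableT_comp mpsi _; exact: measurable_funD.
rewrite -(Rfubini (prod_int mF1 F1_le dom1) F1i F1i').
transitivity (\int[P]_w \int[leb]_v F2 (w, v)); last first.
  rewrite (Rfubini (prod_int mF2 F2_le dom2) F2i F2i').
  by apply: eq_Rintegral => v _; rewrite F2E.
apply: eq_Rintegral => w _.
have [_ <-] := Rintegral_translation (S w) (F2i w).
by apply: eq_Rintegral => s _; rewrite /F1 /F2/= addrK.
Qed.

End bounded_function.

(** Convergence of the convolutions at each point is enough, since [psi] is
    integrable and the convolutions are uniformly bounded. *)
Lemma mollified_cvg (f_ : nat -> mR -> R) (K : R) (x : R) :
  (forall n, measurable_fun (setT : set mR) (f_ n)) ->
  (forall n s, `|f_ n s| <= K) ->
  (forall v, \int[P]_w (W w * f_ n (v - S w)) @[n --> \oo] --> (1 : R)) ->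
  \int[leb]_s (f_ n (s + x) * \int[P]_w (W w * psi (s + S w))) @[n --> \oo]
    --> \int[leb]_v psi v.
Proof.
move=> mf_ fK fcvg.
have mfx n : measurable_fun (setT : set mR) (fun s : mR => f_ n (s + x)).
  by apply: measurableT_comp (mf_ n) _; exact: measurable_funD.
under eq_fun do rewrite (convolution_identity (mfx _) (fun s => fK _ (s + x)))//.
have Wfi n v : P.-integrable setT (EFin \o (fun w => W w * f_ n (v - S w + x))).
  apply: (@integrable_weight_bounded (fun w => f_ n (v - S w + x)) K) => //.
  apply: measurableT_comp (mf_ n) _; apply: measurable_funD => //.
  exact: measurable_funB.
apply: (@dominated_cvg_Rintegral _ _ _ leb
  (fun n v => psi v * \int[P]_w (W w * f_ n (v - S w + x))) psi
  (fun v => `|psi v| * (K * \int[P]_w W w))).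
- move=> n; exact: measurable_convolution (mfx n) (fun s => fK _ (s + x)).
- exact: mpsi.
- by apply: integrableRZr => //; exact: integrable_normr.
- apply: aeW => v n; rewrite normrM ler_wpM2l//.
  rewrite (le_trans (le_normr_Rintegral _ _))// -RintegralZl//.
  apply: le_Rintegral => //.
  + exact: integrable_normr.
  + exact: integrableRZl.
  + by move=> w _; rewrite normrM (ger0_norm (W0 w)) mulrC ler_wpM2r.
- apply: aeW => v; rewrite -[X in _ --> X]mulr1; apply: cvgMr.
  apply: cvg_trans (fcvg (v + x)); apply: near_eq_cvg; apply: nearW => n.
  by apply: eq_Rintegral => w _; rewrite addrAC.
Qed.

End convolution.

(** * The Tauberian theorem *)

Section fejer_mass.
Context (R : realType).
Notation leb := (@lebesgue_measure R).
Notation mR := (measurableTypeR R).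

Lemma fejer_mass_ge (l : R) : 0 < l -> l / 4 <= \int[leb]_t fejer l t.
Proof.
move=> l0; set r := (2 * l)^-1.
have r0 : 0 < r by rewrite invr_gt0 mulr_gt0.
have -> : l / 4 = \int[leb]_t (l ^+ 2 / 4 * (\1_(`[(- r), r] : set R) t)).
  rewrite RintegralZl//; last first.
    exact: integrable_indic_itv.
  rewrite /Rintegral integral_indic// setIT /=.
  rewrite lebesgue_measure_itv/= lte_fin ifT; last by rewrite gtrN.
  by rewrite -EFinB/= opprK /r; field; rewrite gt_eqF.
apply: le_Rintegral => //.
- by apply: integrableRZl => //; exact: integrable_indic_itv.
- exact: integrable_fejer.
move=> t _; rewrite indicE; have [|_] := boolP (t \in _).
  rewrite inE /= in_itv/= mulr1 => tr; apply: fejer_ge => //.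
  by rewrite ler_norml.
by rewrite mulr0 fejer_ge0.
Qed.

End fejer_mass.

Section tauberian.
Context d (T : measurableType d) (R : realType).
Notation leb := (@lebesgue_measure R).
Notation mR := (measurableTypeR R).
Variables (P : {sigma_finite_measure set T -> \bar R}) (W S : T -> R).
Hypothesis mS : measurable_fun setT S.
Hypothesis W0 : forall w, 0 <= W w.
Hypothesis MW : all_moments P S W.
Hypothesis nz : forall x, cos_transform P S W x ^+ 2 + sin_transform P S W x ^+ 2 != 0.
Let m := \int[P]_w W w.
Hypothesis m0 : 0 < m.

Variables (f_ : nat -> mR -> R) (K al : R).
Hypothesis al0 : 0 < al.
Hypothesis mf_ : forall n, measurable_fun (setT : set mR) (f_ n).
Hypothesis f0 : forall n s, 0 <= f_ n s.
Hypothesis fK : forall n s, f_ n s <= K.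
Hypothesis f_mono : forall n s t, s <= t ->
  expR (- (al * t)) * f_ n t <= expR (- (al * s)) * f_ n s.
Hypothesis fcvg :
  forall v, \int[P]_w (W w * f_ n (v - S w)) @[n --> \oo] --> (1 : R).

Let K0 : 0 <= K. Proof. exact: le_trans (fK 0 0). Qed.

Let nfK n s : `|f_ n s| <= K. Proof. by rewrite ger0_norm. Qed.

(** The identity for the constant function 1 computes the integral of psi as the
    mass of the kernel divided by [m]. *)
Lemma fejer_smoothed_cvg (l x : R) : 0 < l ->
  \int[leb]_s (f_ n (s + x) * fejer l s) @[n --> \oo] --> (\int[leb]_s fejer l s) / m.
Proof.
move=> l0; have [mW _] := MW; have Wi := all_moments_integrable MW.
have [psi [cpsi [B psiB] ipsi psiE]] := fejer_division mS W0 MW nz l0.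
have -> : (\int[leb]_s fejer l s) / m = \int[leb]_s psi s.
  have H : \int[leb]_s (1 * \int[P]_w (W w * psi (s + S w))) =
           \int[leb]_v (psi v * \int[P]_w (W w * 1)).
    apply: (@convolution_identity _ _ _ P W S mS mW W0 Wi psi B cpsi psiB ipsi (fun=> 1) 1) => //.
    by move=> s; rewrite normr1.
  have -> : \int[leb]_s fejer l s = \int[leb]_s psi s * m.
    rewrite -RintegralZr//.
    rewrite (_ : m = \int[P]_w (W w * 1)); last by apply: eq_Rintegral => w _; rewrite mulr1.
    by rewrite -H; apply: eq_Rintegral => s _; rewrite psiE mul1r.
  by rewrite mulfK// gt_eqF.
have := @mollified_cvg _ _ _ P W S mS mW W0 Wi psi B cpsi psiB ipsi f_ K x mf_ nfK fcvg.
apply: cvg_trans; apply: near_eq_cvg; apply: nearW => n.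
by apply: eq_Rintegral => s _; rewrite psiE.
Qed.

(** An integrable bound of all the Fejer kernels outside [-h, h]; it does not
    depend on [l], so its mass is negligible against that of the kernel when [l]
    is large. *)
Let tail (h : R) (s : R) := 2 * (1 + h ^- 2) * (1 + s ^+ 2)^-1.

Let fejer_le_tail (l h s : R) : 0 < l -> 0 < h -> h < `|s| -> fejer l s <= tail h s.
Proof.
move=> l0 h0 hs; have s0 : 0 < s ^+ 2.
  by rewrite exprn_even_gt0//= -normr_gt0 (lt_trans h0).
have hs2 : h ^+ 2 <= s ^+ 2.
  by rewrite -[s ^+ 2]real_normK ?num_real// ler_sqr ?nnegrE// ltW.
rewrite /tail ler_pdivlMr; last by rewrite addrC ltr_wpDl ?ltr01// ltW.
have fl := fejer_le l0 s.
have : fejer l s <= 2 * h ^- 2.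
  rewrite ler_pdivlMr ?exprn_gt0// (le_trans _ fl)// mulrC ler_wpM2r//.
  exact: fejer_ge0.
by move: fl; lra.
Qed.

Let tail_ge0 h s : 0 <= tail h s.
Proof.
by rewrite /tail !mulr_ge0 ?invr_ge0 ?addr_ge0 ?invr_ge0 ?exprn_even_ge0.
Qed.

Let integrable_tail h : leb.-integrable setT (EFin \o tail h).
Proof.
exact: (@integrableZl _ _ _ leb setT measurableT (2 * (1 + h ^- 2))
  (fun t => ((1 + t ^+ 2)^-1)%:E) (@integrable_inv_oneDsqr R)).
Qed.

Let f_growth n (s t : R) : s <= t -> f_ n t <= expR (al * (t - s)) * f_ n s.
Proof.
move=> st; rewrite mulrBr expRD -mulrA -ler_pdivrMl ?expR_gt0// -expRN.
exact: f_mono.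
Qed.

(** The monotonicity of [f_ n], up to an exponential factor, makes [f_ n 0] a
    lower bound on the window to its left; the Fejer mean is therefore centred at
    [- h], and at [h] for the converse bound. *)
Let upper n (l h s : R) : 0 < l -> 0 < h ->
  expR (- (2 * al * h)) * f_ n 0 * (fejer l s - tail h s) <= f_ n (s - h) * fejer l s.
Proof.
move=> l0 h0; have fj0 := fejer_ge0 l0 s.
have [sh|sh] := ltrP h `|s|.
  rewrite (@le_trans _ _ 0)// ?mulr_ge0//.
  by rewrite mulr_ge0_le0 ?subr_le0 ?fejer_le_tail// mulr_ge0 ?expR_ge0.
rewrite (@le_trans _ _ (expR (- (2 * al * h)) * f_ n 0 * fejer l s))//.
  by rewrite ler_wpM2l ?mulr_ge0 ?expR_ge0// gerBl.
rewrite ler_wpM2r//.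
move: sh; rewrite ler_norml => /andP[s1 s2].
have sh0 : s - h <= 0 by lra.
rewrite expRN ler_pdivrMl ?expR_gt0// (le_trans (f_growth n sh0))//.
rewrite ler_wpM2r// ler_expR (_ : 2 * al * h = al * (2 * h)); last by ring.
by rewrite ler_pM2l//; lra.
Qed.

Let lower n (l h s : R) : 0 < l -> 0 < h ->
  f_ n (s + h) * fejer l s <=
  expR (2 * al * h) * f_ n 0 * fejer l s + K * tail h s.
Proof.
move=> l0 h0; have fj0 := fejer_ge0 l0 s.
have [sh|sh] := ltrP h `|s|.
  apply: ler_wpDl; first by rewrite !mulr_ge0 ?expR_ge0.
  by rewrite ler_pM// fejer_le_tail.
apply: ler_wpDr; first by rewrite mulr_ge0.
rewrite ler_wpM2r//.
move: sh; rewrite ler_norml => /andP[s1 s2].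
have sh0 : 0 <= s + h by lra.
rewrite (le_trans (f_growth n sh0))// ler_wpM2r// ler_expR.
rewrite (_ : 2 * al * h = al * (2 * h)); last by ring.
by rewrite ler_pM2l//; lra.
Qed.

Let int_smoothed n (l x : R) : 0 < l ->
  leb.-integrable setT (EFin \o (fun s => f_ n (s + x) * fejer l s)).
Proof.
move=> l0.
have iK : leb.-integrable setT (EFin \o (fun s => K * fejer l s)).
  exact: integrableRZl (integrable_fejer l0).
apply: (integrable_dominated _ iK) => [|s].
  apply: measurable_funM.
    by apply: measurableT_comp (mf_ n) _; exact: measurable_funD.
  by apply: continuous_measurable_fun; exact: fejer_continuous.
by rewrite normrM (ger0_norm (fejer_ge0 l0 s)) ler_wpM2r// fejer_ge0.
Qed.

(** The Fejer means centred at [- h] and [h] enclose [f_ n 0] up to the factors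
    [expR (2 * al * h)] and the mass of [tail h]. One first takes [h] small, then
    [l] large, then [n] large. *)
Theorem tauberian : f_ n 0 @[n --> \oo] --> m^-1.
Proof.
apply/cvgrPdist_lt => e e0; pose c := m^-1; have c0 : 0 < c by rewrite invr_gt0.
(* Small enough for q = exp(- 2 al h) to satisfy c / (c + e) < q and
   (c - e) / c < q, the slack left by the two one-sided comparisons. *)
pose h := e / (2 * (c + e)) / (2 * al).
have h0 : 0 < h by rewrite !divr_gt0 ?mulr_gt0 ?addr_gt0.
pose q := expR (- (2 * al * h)).
have q0 : 0 < q by rewrite expR_gt0.
have qge : 1 - e / (2 * (c + e)) <= q.
  have := expR_ge1Dx (- (2 * al * h)); rewrite -/q.
  rewrite [X in 1 + X <= _](_ : _ = - (e / (2 * (c + e)))) // /h.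
  by field; rewrite !gt_eqF// addr_gt0.
have ce0 : 0 < c + e by rewrite addr_gt0.
have q1 : c < q * (c + e).
  apply: (@lt_le_trans _ _ ((1 - e / (2 * (c + e))) * (c + e))); last by rewrite ler_wpM2r// ltW.
  have -> : (1 - e / (2 * (c + e))) * (c + e) = c + e / 2 by field; rewrite gt_eqF.
  lra.
have q2 : c - e < q * c.
  apply: (@lt_le_trans _ _ ((1 - e / (2 * (c + e))) * c)); last by rewrite ler_wpM2r// ltW.
  rewrite mulrBl mul1r ltrD2l ltrN2 mulrAC ltr_pdivrMr ?mulr_gt0//.
  by rewrite ltr_pM2l//; lra.
pose E := \int[leb]_s tail h s.
have E0 : 0 <= E by apply: Rintegral_ge0 => s _; exact: tail_ge0.
(* The mass M of the kernel is at least l / 4 and must beat the three quantities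
   built from the mass E of the tail. *)
pose l := 4 * (q * (c + e) * E / (q * (c + e) - c) + K * E / (q * c - (c - e)) + E + 1).
have qc0 : 0 < q * (c + e) by rewrite mulr_gt0.
have d1 : 0 < q * (c + e) - c by rewrite subr_gt0.
have d2 : 0 < q * c - (c - e) by rewrite subr_gt0.
have x1 : 0 <= q * (c + e) * E / (q * (c + e) - c).
  by rewrite !mulr_ge0 ?invr_ge0 ?(ltW d1) ?(ltW q0) ?(ltW ce0).
have x2 : 0 <= K * E / (q * c - (c - e)).
  by rewrite !mulr_ge0 ?invr_ge0 ?(ltW d2).
have l0 : 0 < l by rewrite mulr_gt0// ltr_wpDl// addr_ge0// addr_ge0.
pose M := \int[leb]_s fejer l s.
have Ml : l / 4 <= M by exact: fejer_mass_ge.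
have M1 : q * (c + e) * E / (q * (c + e) - c) < M by rewrite (lt_le_trans _ Ml)// /l; lra.
have M2 : K * E / (q * c - (c - e)) < M by rewrite (lt_le_trans _ Ml)// /l; lra.
have M3 : E < M by rewrite (lt_le_trans _ Ml)// /l; lra.
have up n : q * f_ n 0 * (M - E) <= \int[leb]_s (f_ n (s - h) * fejer l s).
  have iB : leb.-integrable setT (EFin \o (fun s => fejer l s - tail h s)).
    exact: integrableRB (integrable_fejer l0) (integrable_tail h).
  rewrite /M /E -RintegralB//; last exact: integrable_fejer.
  rewrite -RintegralZl//; apply: le_Rintegral => //.
  - exact: integrableRZl.
  - exact: int_smoothed.
  - by move=> s _; exact: upper.
have lo n : \int[leb]_s (f_ n (s + h) * fejer l s) <= q^-1 * f_ n 0 * M + K * E.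
  rewrite /q expRN invrK.
  have i1 : leb.-integrable setT (EFin \o (fun s => expR (2 * al * h) * f_ n 0 * fejer l s)).
    exact: integrableRZl (integrable_fejer l0).
  have i2 : leb.-integrable setT (EFin \o (fun s => K * tail h s)).
    exact: integrableRZl (integrable_tail h).
  rewrite -RintegralZl//; last exact: integrable_fejer.
  rewrite -RintegralZl//.
  rewrite -RintegralD//; apply: le_Rintegral => //.
  - exact: int_smoothed.
  - exact: integrableRD.
  - by move=> s _; exact: lower.
have := fejer_smoothed_cvg (- h) l0; have := fejer_smoothed_cvg h l0.
rewrite -/M -/c => cvg1 cvg2.
have J1 : q^-1 * (c - e) * M + K * E < M * c.
  move: M2; rewrite ltr_pdivrMr// => M2.
  rewrite -(ltr_pM2l q0) mulrDr (_ : q * (q^-1 * (c - e) * M) = (c - e) * M); last first.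
    by field; rewrite gt_eqF.
  have q_le1 : q <= 1.
    by rewrite /q expR_le1 oppr_le0; apply: mulr_ge0; [rewrite mulr_ge0// ltW|rewrite ltW].
  have : q * (K * E) <= K * E by rewrite ler_piMl// mulr_ge0.
  by move: M2; lra.
have J2 : M * c < q * (c + e) * (M - E).
  by move: M1; rewrite ltr_pdivrMr//; lra.
near=> n.
rewrite ltr_norml; apply/andP; split.
  have : q * f_ n 0 * (M - E) < q * (c + e) * (M - E).
    by rewrite (le_lt_trans (up n))//; near: n; exact: (cvgr_lt (M * c)).
  rewrite ltr_pM2r ?subr_gt0// ltr_pM2l//; lra.
have : q^-1 * (c - e) * M + K * E < q^-1 * f_ n 0 * M + K * E.
  by rewrite (lt_le_trans _ (lo n))//; near: n; exact: (cvgr_gt (M * c)).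
rewrite ltrD2r ltr_pM2r ?(le_lt_trans E0 M3)// ltr_pM2l ?invr_gt0//; lra.
Unshelve. all: by end_near.
Qed.

End tauberian.

(** * Slow variation and logarithmic moments *)

Section slow_variation.
Context (R : realType).
Implicit Types L : R -> R.

Lemma near_pinfty_scale (c : R) (Q : R -> Prop) : 0 < c ->
  (\forall x \near +oo, Q x) -> \forall x \near +oo, Q (c * x).
Proof.
move=> c0 [M [_ MQ]]; exists (M / c); split; first exact: num_real.
by move=> x xM; apply: MQ; rewrite mulrC -ltr_pdivrMr.
Qed.

Lemma cvg_pinfty_scale (c : R) (h : R -> R) (l : R) : 0 < c ->
  h x @[x --> +oo] --> l -> h (c * x) @[x --> +oo] --> l.
Proof.
by move=> c0 hl A /hl; exact: (@near_pinfty_scale c (fun x => A (h x))).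
Qed.

Lemma slowly_varying_equiv L L' (k : R) : 0 < k -> slowly_varying L ->
  L' x / L x @[x --> +oo] --> k -> slowly_varying L'.
Proof.
move=> k0 [Lpos Lsv] LL'.
have L'pos : \forall x \near +oo, 0 < L' x.
  near=> x.
  have Lx : 0 < L x by near: x.
  have : 0 < L' x / L x by near: x; exact: (cvgr_gt k).
  by rewrite pmulr_lgt0 ?invr_gt0.
split=> // c c0.
rewrite (_ : (1 : R) = k * 1 * k^-1); last by rewrite mulr1 divff// gt_eqF.
have h : L' (c * x) / L (c * x) * (L (c * x) / L x) * (L' x / L x)^-1
    @[x --> +oo] --> k * 1 * k^-1.
  apply: cvgM; first by apply: cvgM; [exact: (@cvg_pinfty_scale c (fun x => L' x / L x))|exact: Lsv].
  by apply: cvgV => //; rewrite gt_eqF.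
apply: cvg_trans h; apply: near_eq_cvg; near=> x.
have Lx : 0 < L x by near: x.
have Lcx : 0 < L (c * x) by near: x; exact: (@near_pinfty_scale c (fun x => 0 < L x)).
have L'x : 0 < L' x by near: x.
by field; rewrite !gt_eqF.
Unshelve. all: by end_near. Qed.

End slow_variation.

Section power_moments.
Context (R : realType).
Variables (mu : probability R R) (al de : R).
Hypotheses (al0 : 0 < al) (de0 : 0 < de).
Hypothesis mom : mu.-integrable setT (EFin \o (fun y => y `^ (al + de))).

Lemma powR_expR (y a : R) : 0 < y -> y `^ a = expR (a * ln y).
Proof. by move=> y0; rewrite /powR gt_eqF. Qed.

Lemma powR_expRE (s a : R) : expR s `^ a = expR (a * s).
Proof. by rewrite powR_expR ?expR_gt0// expRK. Qed.

Lemma expn_le_expR (x : R) k : 0 <= x -> x ^+ k <= k`!%:R * expR x.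
Proof.
move=> x0; case: k => [|k].
  by rewrite expr0 fact0 mul1r (le_trans _ (expR_ge1Dx x))// lerDl.
have := expR_ge1Dxn k x0; rewrite -ler_pdivrMl ?ltr0n ?fact_gt0// mulrC.
by lra.
Qed.

(** A power of [ln y] costs an arbitrarily small power of [y] at infinity and of
    [y^-1] at 0; both are available because [al] lies strictly between 0 and
    [al + de]. *)
Lemma powR_ln_bound k : exists C : R, forall y,
  `|y `^ al * ln y ^+ k| <= C * (1 + y `^ (al + de)).
Proof.
pose e := Num.min al de; have e0 : 0 < e by rewrite lt_min al0.
have eal : e <= al by rewrite /e ge_min lexx.
have ede : e <= de by rewrite /e ge_min lexx orbT.
pose C := k`!%:R * e ^- k.
have C0 : 0 <= C by rewrite mulr_ge0// invr_ge0 exprn_ge0// ltW.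
exists (C + 1) => y.
have C1 : 1 <= (C + 1) * (1 + y `^ (al + de)).
  by rewrite mulrDl mul1r; have := powR_ge0 y (al + de); nra.
have [y0|y0] := lerP y 0.
  apply: le_trans C1; rewrite (ln0 y0) normrM normrX normr0 mulr_ile1 ?exprn_ile1//.
  have [->|yn0] := eqVneq y 0; first by rewrite powR0 ?gt_eqF// normr0.
  by rewrite lt0_powR1 ?normr1// lt_neqAle yn0.
set s := ln y.
have sk : `|s| ^+ k <= C * expR (e * `|s|).
  have := @expn_le_expR (e * `|s|) k.
  rewrite mulr_ge0 ?(ltW e0)// => /(_ isT).
  by rewrite exprMn -ler_pdivlMl ?exprn_gt0// /C -mulrA mulrCA.
rewrite normrM normrX (ger0_norm (powR_ge0 _ _)).
apply: (@le_trans _ _ (C * (1 + y `^ (al + de)))); last first.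
  by rewrite ler_wpM2r// ?addr_ge0 ?powR_ge0// lerDl.
rewrite (le_trans (ler_wpM2l (powR_ge0 _ _) sk))// mulrCA ler_wpM2l//.
rewrite !powR_expR// -/s -expRD.
have [s0|s0] := lerP 0 s.
  rewrite ger0_norm// ler_wpDl// ler_expR -mulrDl ler_wpM2r//.
  by rewrite lerD2l.
rewrite ltr0_norm// ler_wpDr ?expR_ge0// -expR0 ler_expR; nra.
Qed.

Lemma all_moments_powR : all_moments mu (@ln R) (fun y => y `^ al).
Proof.
split; first exact: measurable_powR.
move=> k; have [C hC] := powR_ln_bound k.
apply: (@integrable_dominated _ _ _ _ _ (fun y => C * (1 + y `^ (al + de)))) => //.
  apply: measurable_funM; first exact: measurable_powR.
  by apply: measurable_funX; exact: measurable_ln.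
apply: integrableRZl; apply: integrableRD => //.
exact: finite_measure_integrable_cst.
Qed.

End power_moments.

(** * Potter bounds for the tail of a product *)

Section tail_comparison.
Context (R : realType).
Variables (mu : probability R R) (al de : R).
Hypotheses (al0 : 0 < al) (de0 : 0 < de).
Hypothesis mu_pos : {ae mu, forall y, 0 < y}.
Hypothesis mom : mu.-integrable setT (EFin \o (fun y => y `^ (al + de))).
Variable G : R -> R.
Hypothesis mG : measurable_fun setT G.
Hypothesis G0 : forall z, 0 <= G z.
Hypothesis G1 : forall z, G z <= 1.
Hypothesis G_mono : forall z z', z <= z' -> G z' <= G z.

Definition product_tail (x : R) := \int[mu]_y G (x / y).
Local Notation H := product_tail.

Let measurable_quot (x : R) : measurable_fun setT (fun y : R => x / y).
Proof. by apply: measurable_funM => //; exact: measurable_inv. Qed.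

Let mGq (x : R) : measurable_fun setT (fun y : R => G (x / y)).
Proof. exact: measurableT_comp mG (measurable_quot x). Qed.

Lemma integrable_product_tail (x : R) : mu.-integrable setT (EFin \o (fun y : R => G (x / y))).
Proof.
apply: (@integrable_dominated _ _ _ _ _ (fun=> 1)) => //.
  exact: finite_measure_integrable_cst.
by move=> y; rewrite ger0_norm.
Qed.

Lemma product_tail_mono (x x' : R) : x <= x' -> H x' <= H x.
Proof.
move=> xx'; apply: ae_le_Rintegral; try exact: integrable_product_tail.
apply: filterS mu_pos => y y0.
by apply: G_mono; rewrite ler_pM2r// invr_gt0.
Qed.

(** On the event [c <= Y], the product [Y * Z] exceeds [c * z] as soon as [Z]
    exceeds [z]. This is the only comparison of the unknown tail [G] with the
    known tail of the product. *)
Lemma product_tail_ge (c z : R) : 0 < c -> 0 < z ->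
  G z * fine (mu [set y | c <= y]) <= H (c * z).
Proof.
move=> c0 z0.
have mc : measurable [set y : R | c <= y] by rewrite -set_itvcy.
have ic : mu.-integrable setT (EFin \o (\1_[set y : R | c <= y] : R -> R)).
  exact: integrable_indic.
have -> : fine (mu [set y | c <= y]) = \int[mu]_y (\1_[set y : R | c <= y] y : R).
  by rewrite /Rintegral integral_indic// setIT.
rewrite -RintegralZl//; apply: le_Rintegral => //; [exact: integrableRZl|exact: integrable_product_tail|].
move=> y _; rewrite indicE; have [|_] := boolP (y \in _); last by rewrite mulr0.
rewrite inE/= mulr1 => cy; apply: G_mono.
by rewrite ler_pdivrMr ?(lt_le_trans c0)// mulrC ler_pM2l.
Qed.

Lemma law_not_near0 : exists2 c : R, 0 < c & 0 < fine (mu [set y | c <= y]).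
Proof.
apply: contrapT => h.
have mc (c : R) : measurable [set y : R | c <= y] by rewrite -set_itvcy.
have h0 n : mu [set y | n.+1%:R^-1 <= y] = 0%E.
  have [//|n0] := eqVneq (mu [set y | n.+1%:R^-1 <= y]) 0%E.
  exfalso; apply: h; exists n.+1%:R^-1 => //.
  by rewrite fine_gt0// lt0e n0 measure_ge0 ltey_eq fin_num_measure.
have U0 : mu.-negligible (\bigcup_n [set y | n.+1%:R^-1 <= y]).
  by apply: negligible_bigcup => n; apply/(negligibleP _ (mc _)); exact: h0.
have T0 : mu.-negligible setT.
  have [A [mA A0 hA]] := negligibleU mu_pos U0.
  exists A; split => // y _; apply: hA.
  have [y0|y0] := ltrP 0 y; last by left => /=; apply/negP; rewrite -leNgt.
  right; exists (Num.truncn (y^-1)) => //=.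
  rewrite invf_ple ?posrE// ltW//.
  exact: truncnS_gt.
have := probability_setT mu; rewrite (measure_negligible measurableT T0).
by move=> /eqP; rewrite eqe eq_sym oner_eq0.
Qed.

Lemma mean_powR_gt0 : 0 < \int[mu]_y (y `^ al).
Proof.
have [c c0 p0] := law_not_near0.
have mc : measurable [set y : R | c <= y] by rewrite -set_itvcy.
have ic : mu.-integrable setT (EFin \o (\1_[set y : R | c <= y] : R -> R)).
  exact: integrable_indic.
have pE : fine (mu [set y | c <= y]) = \int[mu]_y (\1_[set y : R | c <= y] y : R).
  by rewrite /Rintegral integral_indic// setIT.
apply: (@lt_le_trans _ _ (c `^ al * fine (mu [set y | c <= y]))).
  by rewrite mulr_gt0// powR_gt0.
rewrite pE -RintegralZl//; apply: le_Rintegral => //; first exact: integrableRZl.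
  exact: all_moments_integrable (all_moments_powR al0 de0 mom).
move=> y _; rewrite indicE; have [|_] := boolP (y \in _); last by rewrite mulr0 powR_ge0.
rewrite inE/= mulr1 => cy; apply: ge0_ler_powR => //; rewrite ?nnegrE ?ltW//.
exact: lt_le_trans cy.
Qed.

Variable L : R -> R.
Hypothesis L_sv : slowly_varying L.
Hypothesis HL : forall x : R, 0 < x -> H x = x `^ (- al) * L x.

Lemma product_tail_gt0 : \forall x \near +oo, 0 < H x.
Proof.
have [L0 _] := L_sv; near=> x.
have x0 : 0 < x by [].
rewrite HL// mulr_gt0 ?powR_gt0//; near: x; exact: L0.
Unshelve. all: by end_near. Qed.

Lemma product_tail_ratio (c : R) : 0 < c ->
  H (c * x) / H x @[x --> +oo] --> c `^ (- al).
Proof.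
move=> c0; have [_ /(_ c c0) Lc] := L_sv.
have h : c `^ (- al) * (L (c * x) / L x) @[x --> +oo] --> c `^ (- al) * 1.
  by apply: cvgM => //; exact: cvg_cst.
rewrite mulr1 in h; apply: cvg_trans h; apply: near_eq_cvg; near=> x.
have x0 : 0 < x by [].
rewrite !HL ?mulr_gt0// powRM ?ltW//.
have := powR_gt0 (- al) x0; move: (x `^ _) => t t0.
rewrite invfM -[LHS]mulr1 -(divff (lt0r_neq0 t0)); ring.
Unshelve. all: by end_near. Qed.

(** Induction on dyadic scales. Halving [x] multiplies [H x] by at most
    [2 `^ (al + de)] for large [x], because the limiting factor is [2 `^ al]. It
    remains to treat [z] within a factor 2 of [x], where [G z] is compared with [H]
    by [product_tail_ge], and [x] in the first scale, where [G <= 1] and [H] is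
    bounded below. *)
Lemma potter_bound : exists x0 C : R, [/\ 0 < x0, 0 <= C,
  forall x : R, x0 <= x -> 0 < H x &
  forall x z : R, x0 <= x -> 0 < z -> z <= x ->
    G z <= C * (x / z) `^ (al + de) * H x].
Proof.
have [c c0 p0] := law_not_near0; set p := fine _ in p0.
have b0 : 0 < al + de by rewrite addr_gt0.
have half0 : 0 < 2^-1 :> R by [].
have half_pow (a : R) : 2^-1 `^ a = 2 `^ (- a) by rewrite -powR_inv1// -powRrM mulN1r.
have [M [_ hM]] : \forall x \near +oo, [/\ 0 < x, 0 < H x,
    H (2^-1 * x) <= 2 `^ (al + de) * H x &
    H (c / 2 * x) <= ((c / 2) `^ (- al) + 1) * H x].
  near=> x.
  have x0 : 0 < x by [].
  have Hx : 0 < H x by near: x; exact: product_tail_gt0.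
  split=> //.
    rewrite -ler_pdivrMr//; near: x.
    apply: (cvgr_le (2^-1 `^ (- al))); first exact: product_tail_ratio.
    rewrite half_pow opprK !powR_expR// ltr_expR mulrDl ltrDl mulr_gt0//.
    by rewrite ln_gt0// ltr1n.
  rewrite -ler_pdivrMr//; near: x.
  apply: (cvgr_le ((c / 2) `^ (- al))); last by rewrite ltrDl.
  by apply: product_tail_ratio; rewrite divr_gt0.
(* One more than M since the estimates hold for x > M only, whereas x0 itself
   must qualify. *)
pose x0 := Num.max M 0 + 1.
have x0M (x : R) : x0 <= x -> M < x.
  by move=> ?; rewrite (lt_le_trans _ (_ : x0 <= _))// /x0 ltr_pwDr// le_max lexx.
have x00 : 0 < x0 by rewrite /x0 ltr_pwDr// le_max lexx orbT.
have H2 : 0 < H (2 * x0).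
  by have [|] := hM (2 * x0) => //; apply: x0M; lra.
pose C2 := (c / 2) `^ (- al) + 1.
have C20 : 0 < C2 by rewrite ltr_wpDl// powR_ge0.
pose C := (H (2 * x0))^-1 + C2 / p.
have C0 : 0 < C by rewrite addr_gt0 ?invr_gt0 ?divr_gt0.
exists x0, C; split => //; first exact: ltW.
  by move=> x /x0M /hM[].
have ratio1 (x z : R) : 0 < z -> z <= x -> 1 <= (x / z) `^ (al + de).
  move=> z0 zx; have <- : 1 `^ (al + de) = 1 :> R by rewrite powR1.
  rewrite ge0_ler_powR ?nnegrE ?(ltW b0)//.
    by rewrite divr_ge0// ltW// (lt_le_trans z0).
  by rewrite ler_pdivlMr// mul1r.
suff main n (x z : R) : x0 <= x -> x <= 2 ^+ n * (2 * x0) -> 0 < z -> z <= x ->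
    G z <= C * (x / z) `^ (al + de) * H x.
  move=> x z x0x z0 zx.
  pose n := Num.truncn (x / (2 * x0)); apply: (main n) => //.
  rewrite -ler_pdivrMr ?mulr_gt0// ltW// (lt_le_trans (truncnS_gt _))//.
  by rewrite -natrX ler_nat ltn_expl.
have base (u v : R) : x0 <= u -> u <= 2 * x0 -> 0 < v -> v <= u ->
    G v <= C * (u / v) `^ (al + de) * H u.
  move=> x0u un v0 vu; have Hu := product_tail_mono un.
  rewrite (le_trans (G1 v))// mulrAC -[1]mulr1 ler_pM ?ratio1//.
  rewrite -[1](mulVf (lt0r_neq0 H2)) ler_pM ?invr_ge0 ?(ltW H2)//.
  by rewrite lerDl divr_ge0// ltW.
elim: n x z => [|n IHn] x z x0x xn z0 zx.
  by apply: base => //; rewrite expr0 mul1r in xn.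
have [x2|x2] := lerP x (2 * x0); first exact: base.
have [xp Hx Hh Hc] := hM x (x0M _ x0x).
have [zh|zh] := lerP z (2^-1 * x).
  have xn' : 2^-1 * x <= 2 ^+ n * (2 * x0) by rewrite exprS in xn; move: xn; lra.
  have := IHn (2^-1 * x) z; rewrite ler_pdivlMl// => /(_ (ltW x2)).
  move=> /(_ xn' z0 zh) /le_trans; apply.
  rewrite -!mulrA ler_pM2l// powRM ?divr_ge0 ?(ltW z0) ?(ltW xp)//.
  rewrite mulrAC mulrC ler_wpM2l ?powR_ge0//.
  by rewrite half_pow powRN ler_pdivrMl ?powR_gt0.
have Gz : G z * p <= C2 * H x.
  apply: le_trans Hc; apply: le_trans (product_tail_ge c0 z0) _.
  by apply: product_tail_mono; rewrite -mulrA ler_pM2l// ltW.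
rewrite -ler_pdivlMr// in Gz; apply: (le_trans Gz).
rewrite mulrAC ler_wpM2r ?(ltW Hx)//.
rewrite -[leLHS]mulr1 ler_pM ?ratio1// ?divr_ge0 ?(ltW C20) ?(ltW p0)//.
by rewrite lerDr invr_ge0 ltW.
Unshelve. all: by end_near.
Qed.

End tail_comparison.

(** * The tail of Z is equivalent to the tail of Y Z *)

Section tail_equivalence.
Context (R : realType).
Notation mR := (measurableTypeR R).
Variables (mu : probability R R) (al de : R).
Hypotheses (al0 : 0 < al) (de0 : 0 < de).
Hypothesis mu_pos : {ae mu, forall y, 0 < y}.
Hypothesis mom : mu.-integrable setT (EFin \o (fun y => y `^ (al + de))).
Variable G : R -> R.
Hypothesis mG : measurable_fun setT G.
Hypothesis G0 : forall z, 0 <= G z.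
Hypothesis G1 : forall z, G z <= 1.
Hypothesis G_mono : forall z z' : R, z <= z' -> G z' <= G z.
Local Notation H := (product_tail mu G).
Variable L : R -> R.
Hypothesis L_sv : slowly_varying L.
Hypothesis HL : forall x : R, 0 < x -> H x = x `^ (- al) * L x.

Local Notation W := (fun y : R => y `^ al).
Hypothesis nz : forall x, cos_transform mu (@ln R) W x ^+ 2 + sin_transform mu (@ln R) W x ^+ 2 != 0.
Let m := \int[mu]_y W y.

Let m_gt0 : 0 < m.
Proof. exact: mean_powR_gt0 al0 de0 mu_pos mom. Qed.

Let ratio (x s : R) := expR (al * s) * (G (x * expR s) / H x).

(** The weight exactly compensates the exponential factor of the rescaled tail,
    so that the expectation of the left-hand side is a value of [H]. *)
Let weight_ratio (x v y : R) : 0 < y ->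
  y `^ al * ratio x (v - ln y) = expR (al * v) * (G (x * expR v / y) / H x).
Proof.
move=> y0; rewrite /ratio powR_expR//.
have -> : x * expR (v - ln y) = x * expR v / y by rewrite expRB lnK ?posrE// mulrA.
by rewrite mulrA -expRD; congr (expR _ * _); ring.
Qed.

Let ratio_ge0 x s : 0 < H x -> 0 <= ratio x s.
Proof. by move=> Hx; rewrite !mulr_ge0 ?expR_ge0 ?invr_ge0 ?(ltW Hx). Qed.

Let measurable_truncated_ratio K x :
  measurable_fun (setT : set mR) (fun s : mR => Num.min K (ratio x s) : R).
Proof.
apply: measurable_minr => //.
apply: measurable_funM.
  by apply: (measurableT_comp (@measurable_expR R)); exact: measurable_funM.
apply: measurable_funM => //.
apply: (measurableT_comp mG); apply: measurable_funM => //.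
Qed.

Let truncated_ratio_mono (K x s t : R) : 0 <= K -> 0 < x -> 0 < H x -> s <= t ->
  expR (- (al * t)) * Num.min K (ratio x t) <= expR (- (al * s)) * Num.min K (ratio x s).
Proof.
move=> K0 x0 Hx st; rewrite !minr_pMr ?expR_ge0//.
have E r : expR (- (al * r)) * ratio x r = G (x * expR r) / H x.
  by rewrite /ratio mulrA -expRD addNr expR0 mul1r.
rewrite !E le_min !ge_min; apply/andP; split.
  by rewrite ler_wpM2r// ler_expR lerN2 ler_pM2l// st.
apply/orP; right; rewrite ler_wpM2r ?invr_ge0 ?(ltW Hx)// G_mono//.
by rewrite ler_pM2l// ler_expR.
Qed.

(** The truncated rescaled tails satisfy the hypotheses of the Tauberian theorem:
    their level [K] exceeds the limit superior of [ratio x s], which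
    [product_tail_ge] bounds by the same number for every [s]. *)
Lemma tail_equivalence : G x / H x @[x --> +oo] --> m^-1.
Proof.
have [x0 [C [x00 C0 Hpos potter]]] :=
  potter_bound al0 de0 mu_pos mG G0 G1 G_mono L_sv HL.
have [c c0 p0] := law_not_near0 mu_pos; set p := fine _ in p0.
have MW := all_moments_powR al0 de0 mom.
have Wi := all_moments_integrable MW.
have [mW _] := MW.
have W0 (y : R) : 0 <= y `^ al by exact: powR_ge0.
pose K := c `^ (- al) / p + 1.
have K0 : 0 < K by rewrite ltr_wpDl// divr_ge0 ?powR_ge0// ltW.
apply/cvg_pinftyP => u uoo.
pose x_ n := Num.max (u n) x0.
have x_ge n : x0 <= x_ n by rewrite le_max lexx orbT.
have x_gt0 n : 0 < x_ n by exact: lt_le_trans (x_ge n).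
have Hx n : 0 < H (x_ n) by exact: Hpos.
have ux : \forall n \near \oo, x_ n = u n.
  near=> n; apply/max_idPl; near: n.
  by move/cvgryPge : uoo; apply.
have xoo : x_ n @[n --> \oo] --> +oo.
  by apply: cvg_trans uoo; apply: near_eq_cvg; apply: filterS ux => n ->.
have Hratio (k : R) : 0 < k -> H (k * x_ n) / H (x_ n) @[n --> \oo] --> k `^ (- al).
  by move=> k0; have /cvg_pinftyP := product_tail_ratio L_sv HL k0; exact.
have ratio_K s : \forall n \near \oo, ratio (x_ n) s <= K.
  have k0 : 0 < c * expR s by rewrite mulr_gt0 ?expR_gt0.
  have lim : expR (al * s) / p * (H (c * expR s * x_ n) / H (x_ n)) @[n --> \oo]
      --> c `^ (- al) / p.
    rewrite (_ : c `^ (- al) / p = expR (al * s) / p * (c * expR s) `^ (- al)).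
      by apply: cvgM; [exact: cvg_cst|exact: Hratio].
    rewrite powRM ?expR_ge0 ?(ltW c0)// powR_expRE mulNr expRN.
    by field; rewrite !gt_eqF ?expR_gt0.
  near=> n.
  apply: (@le_trans _ _ (expR (al * s) / p * (H (c * expR s * x_ n) / H (x_ n)))).
    rewrite /ratio -[leRHS]mulrA ler_wpM2l ?expR_ge0// [leRHS]mulrA ler_wpM2r ?invr_ge0 ?(ltW (Hx n))//.
    rewrite [leRHS]mulrC ler_pdivlMr// (_ : c * expR s * x_ n = c * (x_ n * expR s)); last by ring.
    by apply: product_tail_ge => //; rewrite mulr_gt0 ?expR_gt0.
  near: n; apply: (cvgr_le (c `^ (- al) / p)) => //.
  by rewrite /K ltrDl.
have mf n : measurable_fun (setT : set mR) (fun s : mR => Num.min K (ratio (x_ n) s)).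
  exact: measurable_truncated_ratio.
have f0 n s : 0 <= Num.min K (ratio (x_ n) s).
  by rewrite le_min (ltW K0) ratio_ge0.
have fK n s : Num.min K (ratio (x_ n) s) <= K by rewrite ge_min lexx.
(* Without the truncation, the expectation is a value of H; the excess over the
   truncated integrand tends to 0 pointwise and is dominated by the Potter bound. *)
pose full n (v y : R) := expR (al * v) * (G (x_ n * expR v / y) / H (x_ n)).
pose cut n (v y : R) := y `^ al * Num.min K (ratio (x_ n) (v - ln y)).
have iG (x : R) := integrable_product_tail mu mG G0 G1 x.
have ifull n v : mu.-integrable setT (EFin \o full n v).
  by apply: integrableRZl; apply: integrableRZr.
have icut n v : mu.-integrable setT (EFin \o cut n v).
  apply: (@integrable_weight_bounded _ _ _ mu (fun y : R => y `^ al) _ _ _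
    (fun y => Num.min K (ratio (x_ n) (v - ln y))) K) => //.
    by apply: measurableT_comp (mf n) _; apply: measurable_funB => //; exact: measurable_ln.
  by move=> y; rewrite ger0_norm.
have full_cvg v : \int[mu]_y full n v y @[n --> \oo] --> (1 : R).
  have E n : \int[mu]_y full n v y = expR (al * v) * (H (expR v * x_ n) / H (x_ n)).
    rewrite RintegralZl//; last exact: integrableRZr.
    by rewrite RintegralZr// [expR v * _]mulrC.
  under eq_fun do rewrite E.
  rewrite (_ : 1 = expR (al * v) * expR v `^ (- al)).
    by apply: cvgM; [exact: cvg_cst|apply: Hratio; exact: expR_gt0].
  by rewrite powR_expRE mulNr -expRD subrr expR0.
have cut_le n v y : 0 < y -> 0 <= cut n v y <= full n v y.
  move=> y0; rewrite /cut /full mulr_ge0//= -weight_ratio// ler_wpM2l//.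
  by rewrite ge_min lexx orbT.
have excess_cvg v : \int[mu]_y (full n v y - cut n v y) @[n --> \oo] --> (0 : R).
  rewrite (_ : 0 = \int[mu]_y (0 : R)); last by rewrite /Rintegral integral0.
  apply: (@dominated_cvg_Rintegral _ _ _ mu (fun n y => full n v y - cut n v y) (fun=> 0)
    (fun y => expR (al * v) * (C * (1 + y `^ (al + de) * expR (- v) `^ (al + de))))) => //.
  - move=> n; have /measurable_int/measurable_EFinP := integrableRB (ifull n v) (icut n v).
    exact.
  - apply: integrableRZl; apply: integrableRZl; apply: integrableRD.
      exact: finite_measure_integrable_cst.
    exact: integrableRZr.
  - apply: filterS mu_pos => y y0 n.
    have /andP[c1 c2] := cut_le n v y y0.
    rewrite ger0_norm ?subr_ge0// (@le_trans _ _ (full n v y)) ?gerBl//.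
    rewrite ler_wpM2l ?expR_ge0// ler_pdivrMr//.
    have z0 : 0 < x_ n * expR v / y by rewrite divr_gt0 ?mulr_gt0 ?expR_gt0.
    have [zx|zx] := lerP (x_ n * expR v / y) (x_ n).
      apply: (le_trans (potter _ _ (x_ge n) z0 zx)).
      rewrite ler_wpM2r ?(ltW (Hx n))// ler_wpM2l// expRN -powRM ?(ltW y0) ?invr_ge0 ?expR_ge0//.
      rewrite (_ : x_ n / _ = y / expR v) ?lerDr ?ler01//.
      by field; rewrite !gt_eqF ?expR_gt0.
    apply: (le_trans (G_mono (ltW zx))).
    apply: (le_trans (potter _ _ (x_ge n) (x_gt0 n) (lexx _))).
    rewrite ler_wpM2r ?(ltW (Hx n))// divff ?gt_eqF// powR1 ler_wpM2l//.
    by rewrite lerDl mulr_ge0 ?powR_ge0.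
  - apply: filterS mu_pos => y y0; apply: cvg_near_cst.
    have := ratio_K (v - ln y); apply: filterS => n rK.
    by rewrite /cut min_r// weight_ratio// subrr.
have fcvg v : \int[mu]_y cut n v y @[n --> \oo] --> (1 : R).
  have h : \int[mu]_y full n v y - \int[mu]_y (full n v y - cut n v y)
      @[n --> \oo] --> (1 - 0 : R).
    by apply: cvgB; [exact: full_cvg|exact: excess_cvg].
  rewrite subr0 in h; apply: cvg_trans h; apply: near_eq_cvg; apply: nearW => n.
  rewrite -RintegralB//; last exact: integrableRB.
  by apply: eq_Rintegral => y _; rewrite opprB addrC subrK.
have := @tauberian _ _ R mu (fun y : R => y `^ al) (@ln R) (@measurable_ln R) W0 MW nz m_gt0
  (fun n s => Num.min K (ratio (x_ n) s)) K al al0 mf f0 fK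
  (fun n s t => truncated_ratio_mono (ltW K0) (x_gt0 n) (Hx n)) fcvg.
apply: cvg_trans; apply: near_eq_cvg; near=> n.
have xE : x_ n = u n by near: n.
have rK : ratio (x_ n) 0 <= K by near: n; exact: ratio_K.
by rewrite min_r// /ratio mulr0 expR0 mul1r mulr1 xE.
Unshelve. all: by end_near.
Qed.

End tail_equivalence.

(** * Laws with a given tail and laws of products *)

Section law_of_tail.
Context (R : realType).
Variable G : R -> R.
Hypothesis G_mono : forall z z' : R, z <= z' -> G z' <= G z.
Hypothesis G_cont : continuous G.
Hypothesis G_Ny : G x @[x --> -oo] --> (1 : R).
Hypothesis G_y : G x @[x --> +oo] --> (0 : R).

Let F (x : R) : R := 1 - G x.

Let F_nd : nondecreasing F.
Proof. by move=> x y xy; rewrite lerD2l lerN2; exact: G_mono. Qed.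

Let F_rc : right_continuous F.
Proof.
move=> x; apply: cvg_at_right_filter.
by apply: cvgB; [exact: cvg_cst|exact: G_cont].
Qed.

HB.instance Definition _ := isCumulative.Build R _ R F F_nd F_rc.

Let F_Ny : F @ -oo --> (0 : R).
Proof. by rewrite -(subrr 1); apply: cvgB => //; exact: cvg_cst. Qed.

Let F_y : F @ +oo --> (1 : R).
Proof. by rewrite -[in X in _ --> X](subr0 1); apply: cvgB => //; exact: cvg_cst. Qed.

HB.instance Definition _ := isCumulativeBounded.Build R 0 1 F F_Ny F_y.

(** Lebesgue-Stieltjes measure of the distribution function [1 - G]. *)
Lemma exists_law_of_tail :
  exists nu : probability R R, forall x, nu [set t | x < t] = (G x)%:E.
Proof.
pose lsf : probability (measurableTypeR R) R := lebesgue_stieltjes_measure F.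
have mid : measurable_fun setT (idfun : measurableTypeR R -> R) by exact: measurable_id.
pose X : {RV lsf >-> R} := HB.pack (idfun : measurableTypeR R -> R)
  (isMeasurableFun.Build _ _ _ _ _ mid).
pose nu : probability R R := distribution lsf X.
exists nu => x.
have XE : nu `]-oo, x]%classic = (F x)%:E.
  exact: (@cdf_lebesgue_stieltjes_id R F x).
have -> : [set t | x < t] = ~` `]-oo, x]%classic.
  by apply/seteqP; split => t /=; rewrite in_itv/= ltNge => /negP.
by rewrite probability_setC// XE -EFinB /F opprB addrC subrK.
Qed.

End law_of_tail.

Section product_law.
Context (R : realType).
Variables (mu nu : probability R R).
Hypothesis mu_pos : {ae mu, forall y, 0 < y}.

Lemma measurable_mul_gt (x : R) : measurable [set z : R * R | x < z.1 * z.2].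
Proof.
rewrite -[X in measurable X]setTI.
have -> : [set z : R * R | x < z.1 * z.2] = (fun z : R * R => z.1 * z.2) @^-1` `]x, +oo[%classic.
  by apply/seteqP; split => z /=; rewrite in_itv/= andbT.
apply: (@measurable_funM _ _ _ _ fst snd) => //.
Qed.

Let mray (z : R) : measurable [set t : R | z < t].
Proof. by rewrite -set_itvoy. Qed.

Lemma tail_mono (z z' : R) : z <= z' ->
  fine (nu [set t | z' < t]) <= fine (nu [set t | z < t]).
Proof.
move=> zz'; rewrite fine_le ?fin_num_measure//.
by apply: le_measure; rewrite ?inE// => t /=; exact: le_lt_trans.
Qed.

Lemma tail_ge0 (z : R) : 0 <= fine (nu [set t | z < t]).
Proof. exact: fine_ge0. Qed.

Lemma tail_le1 (z : R) : fine (nu [set t | z < t]) <= 1.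
Proof. by rewrite -lee_fin fineK ?fin_num_measure// probability_le1. Qed.

Lemma measurable_tail : measurable_fun setT (fun z : R => fine (nu [set t | z < t])).
Proof. by apply: nonincreasing_measurable => // z z'; exact: tail_mono. Qed.

Lemma product_law_tail (x : R) :
  (mu \x nu)%E [set z : R * R | x < z.1 * z.2] =
  (product_tail mu (fun z => fine (nu [set t | z < t])) x)%:E.
Proof.
have mA := measurable_mul_gt x.
have fin (z : R) : nu [set t | z < t] \is a fin_num by exact: fin_num_measure.
set A := [set z : R * R | x < z.1 * z.2] in mA *.
have -> : (mu \x nu)%E A = (\int[mu]_y nu (xsection A y))%E by [].
rewrite /product_tail /Rintegral fineK; last first.
  apply/integrable_fin_num => //.
  exact: (integrable_product_tail mu measurable_tail tail_ge0 tail_le1).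
apply: ae_eq_integral => //.
- exact: measurable_fun_xsection.
- have /measurable_int := integrable_product_tail mu measurable_tail tail_ge0 tail_le1 x.
  exact.
apply: filterS mu_pos => y y0 _.
rewrite fineK//; congr (nu _); apply/seteqP; split => t /=; rewrite /xsection/= inE/=.
  by rewrite ltr_pdivrMr// mulrC.
by rewrite ltr_pdivrMr// mulrC.
Qed.

End product_law.

Lemma independent_joint_law d (T : measurableType d) (R : realType)
    (P : probability T R) (Y Z : {RV P >-> R}) (mu : probability R R) :
  (forall A : set R, measurable A -> distribution P Y A = mu A) ->
  independent_RV Y Z ->
  forall A : set (R * R), measurable A ->
    P [set w | A (Y w, Z w)] = (mu \x distribution P Z)%E A.
Proof.
move=> Ymu indep A mA.
have mYZ : measurable_fun setT (fun w => (Y w, Z w)) by exact: measurable_fun_pair.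
pose YZ : {mfun T >-> (R * R)%type} := HB.pack (fun w => (Y w, Z w)) (isMeasurableFun.Build _ _ _ _ _ mYZ).
rewrite (@product_measure_unique _ _ _ _ _ mu (distribution P Z) (pushforward P YZ))//.
move=> B C mB mC.
transitivity (P (Y @^-1` B `&` Z @^-1` C)); first by [].
by rewrite indep//; congr (_ * _)%E; exact: Ymu.
Qed.

(** * A log-periodic tail *)

Section oscillating_tail.
Context (R : realType).
Variables (al t : R).
Hypotheses (al0 : 0 < al) (t0 : 0 < t).

Lemma powRN_cvg0 (b : R) : 0 < b -> x `^ (- b) @[x --> +oo] --> (0 : R).
Proof.
move=> b0; apply/cvgrPdist_lt => e e0; near=> x.
have x0 : 0 < x by [].
rewrite sub0r normrN ger0_norm ?powR_ge0// powRN invf_plt ?posrE ?powR_gt0//.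
have x1 : expR (e^-1 / b) < x by near: x; apply: nbhs_pinfty_gt; exact: num_real.
rewrite powR_expR// (lt_le_trans _ (expR_ge1Dx _))// ltr_pwDl// mulrC.
by rewrite -ler_pdivrMr// -ler_expR lnK ?posrE// ltW.
Unshelve. all: by end_near. Qed.

(** Small enough for the oscillation not to destroy monotonicity, which needs
    [a * (al + t) <= al], and for [1 - a] to be positive. *)
Definition amplitude := al / (2 * (al + t)).
Local Notation a := amplitude.

Let a0 : 0 < a.
Proof. by rewrite divr_gt0// mulr_gt0// addr_gt0. Qed.

Lemma amplitude_lt1 : a < 1.
Proof.
by rewrite /amplitude ltr_pdivrMr ?mulr_gt0 ?addr_gt0// mul1r; have := t0; have := al0; lra.
Qed.

Let a_slope : a * (al + t) <= al.
Proof.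
rewrite /amplitude (_ : _ * _ = al / 2); last by field; rewrite gt_eqF// addr_gt0.
by have := al0; lra.
Qed.

(** The tail in the logarithmic variable. *)
Definition oscillation (s : R) := expR (- (al * s)) * (1 + a * cos (s * t)).

Let osc_bound s : 0 <= 1 + a * cos (s * t) <= 1 + a.
Proof.
have := cos_geN1 (s * t); have := cos_le1 (s * t); move: (cos _) => c c1 c2.
by have := a0; have := amplitude_lt1; nra.
Qed.

Lemma is_derive_oscillation (s : R) : is_derive s 1 oscillation
  (- expR (- (al * s)) * (al * (1 + a * cos (s * t)) + a * t * sin (s * t))).
Proof.
have dlin : is_derive s 1 (fun s => - (al * s)) (- al).
  have h := is_derive_mul (is_derive_const (- al) s) (is_derive_id s 1).
  rewrite mul0r add0r mulr1 in h.
  by under eq_fun do rewrite -mulNr.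
have dexp : is_derive s 1 (fun s => expR (- (al * s))) (- al * expR (- (al * s))).
  have de : is_derive (- (al * s)) 1 (@expR R) (expR (- (al * s))).
    exact: is_derive_expR.
  have := @is_derive1_comp _ (@expR R) (fun s => - (al * s)) s _ _ de dlin.
  by rewrite mulrC.
have h := is_derive_mul dexp (is_derive_add (is_derive_const 1 s)
  (is_derive_mul (is_derive_const a s) (is_derive_cosM t s))).
by refine (is_derive_eq h _); ring.
Qed.

Lemma oscillation_mono (s s' : R) : s <= s' -> oscillation s' <= oscillation s.
Proof.
rewrite le_eqVlt => /predU1P[->//|ss'].
have cosc : {within `[s, s'], continuous oscillation}.
  by apply: continuous_subspaceT; exact: is_derive_continuous is_derive_oscillation.
have [c _] := MVT ss' (fun x _ => is_derive_oscillation x) cosc.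
move=> E; rewrite -subr_le0 E mulr_le0_ge0//; last by rewrite subr_ge0 ltW.
rewrite mulNr oppr_le0 mulr_ge0 ?expR_ge0//.
have := cos_geN1 (c * t); have := sin_geN1 (c * t).
move: (cos _) (sin _) => C S hS hC.
have h1 : a * t * -1 <= a * t * S by rewrite ler_pM2l// mulr_gt0.
have h2 : al * (a * -1) <= al * (a * C) by rewrite !ler_pM2l.
by have := a_slope; lra.
Qed.

(** Freezing the argument below 1 extends the tail by the constant 1, the value
    at 1 being normalized by [1 + a]. *)
Definition oscillating_tail (x : R) := oscillation (ln (Num.max 1 x)) / (1 + a).
Local Notation G := oscillating_tail.

Let a1 : 0 < 1 + a. Proof. by rewrite addr_gt0. Qed.

Let max1_gt0 (x : R) : 0 < Num.max 1 x. Proof. by rewrite lt_max ltr01. Qed.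

Lemma oscillating_tail_mono (z z' : R) : z <= z' -> G z' <= G z.
Proof.
move=> zz'; rewrite ler_pM2r ?invr_gt0// oscillation_mono//.
rewrite ler_ln ?posrE//.
by rewrite ge_max !le_max lexx zz' orbT.
Qed.

Lemma oscillating_tail_continuous : continuous G.
Proof.
have cm : continuous (fun x : R => Num.max 1 x).
  have -> : (fun x : R => Num.max 1 x) = (fun x => 2^-1 * (1 + x + `|1 - x|)).
    by apply/funext => x; rewrite maxr_absE mulrC.
  apply: (@Cn_mul _ 0); first exact: Cn_cst.
  apply: (@Cn_add _ 0).
    by apply: (@Cn_add _ 0); [exact: Cn_cst|exact: (@Cn_id _ 0)].
  exact/continuous_normr/(@Cn_subl _ 0).
have cl : continuous (fun x : R => ln (Num.max 1 x)).
  by move=> x; apply: (continuous_comp (cm x)); exact: continuous_ln.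
have co : continuous (fun x : R => oscillation (ln (Num.max 1 x))).
  move=> x; apply: (continuous_comp (cl x)).
  exact: is_derive_continuous is_derive_oscillation _.
by apply: (@Cn_mul _ 0) => //; exact: (@Cn_cst _ 0).
Qed.

Lemma oscillating_tail_le1E (x : R) : x <= 1 -> G x = 1.
Proof.
move=> x1; rewrite /oscillating_tail max_l// ln1 /oscillation mulr0 oppr0 expR0.
by rewrite mul0r cos0 mulr1 mul1r divff// gt_eqF.
Qed.

Lemma oscillating_tail_ge1E (x : R) : 1 <= x ->
  G x = x `^ (- al) * ((1 + a * cos (ln x * t)) / (1 + a)).
Proof.
move=> x1; have x0 : 0 < x by exact: lt_le_trans x1.
by rewrite /oscillating_tail max_r// /oscillation powR_expR// mulNr mulrA.
Qed.

Let ratio01 s : 0 <= (1 + a * cos (s * t)) / (1 + a) <= 1.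
Proof.
have /andP[b1 b2] := osc_bound s.
by rewrite divr_ge0 ?(ltW a1)//= ler_pdivrMr// mul1r.
Qed.

Lemma oscillating_tail_law :
  exists nu : probability R R, forall x, nu [set u | x < u] = (G x)%:E.
Proof.
apply: exists_law_of_tail.
- exact: oscillating_tail_mono.
- exact: oscillating_tail_continuous.
- apply: cvg_near_cst; near=> x; apply: oscillating_tail_le1E.
  by near: x; apply: nbhs_ninfty_le; exact: num_real.
- apply: (@squeeze_cvgr _ _ _ _ (fun=> 0) (fun x => x `^ (- al))).
  + near=> x; have x1 : 1 <= x by near: x; apply: nbhs_pinfty_ge; exact: num_real.
    have /andP[r0 r1] := ratio01 (ln x).
    by rewrite oscillating_tail_ge1E// mulr_ge0 ?powR_ge0//= ler_piMr ?powR_ge0.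
  + exact: cvg_cst.
  + exact: powRN_cvg0.
Unshelve. all: by end_near. Qed.

Lemma cos_period_nat n : cos (n%:R * (pi *+ 2)) = 1 :> R.
Proof.
elim: n => [|n IHn]; first by rewrite mul0r cos0.
by rewrite -addn1 natrD mulrDl mul1r cosD2pi.
Qed.

(** Multiplying [x] by [expR (pi / t)] reverses the sign of the cosine, so the
    ratio equals [(1 - a) / (1 + a)] at arbitrarily large points. *)
Lemma oscillating_not_slowly_varying (L : R -> R) :
  (forall x, 1 <= x -> L x = (1 + a * cos (ln x * t)) / (1 + a)) ->
  ~ slowly_varying L.
Proof.
move=> LE [_ Lsv].
pose c := expR (pi / t); have c0 : 0 < c by exact: expR_gt0.
have c1 : 1 <= c by rewrite -expR0 ler_expR divr_ge0 ?pi_ge0// ltW.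
have gap : (1 - a) / (1 + a) < 1 by rewrite ltr_pdivrMr// mul1r; have := a0; lra.
have [M [_ hM]] : \forall x \near +oo, (1 - a) / (1 + a) < L (c * x) / L x.
  exact: (cvgr_gt 1 (Lsv c c0)).
pose n := Num.truncn (`|M| * t).
pose x := expR (n.+1%:R * (pi *+ 2) / t).
have x1 : 1 <= x.
  by rewrite -expR0 ler_expR divr_ge0 ?(ltW t0)// mulr_ge0// mulrn_wge0// pi_ge0.
have xM : M < x.
  rewrite (le_lt_trans (ler_norm M))// (lt_le_trans _ (expR_ge1Dx _))//.
  rewrite (@lt_le_trans _ _ (n.+1%:R * (pi *+ 2) / t)) ?lerDr//.
  rewrite ltr_pdivlMr// (lt_le_trans (truncnS_gt _))// -/n ler_peMr//.
  by have := pi_ge2 R; rewrite mulr2n; lra.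
have := hM x xM.
have cx1 : 1 <= c * x by rewrite -[1]mulr1 ler_pM.
rewrite !LE// lnM ?posrE ?expR_gt0// !expRK.
have -> : (pi / t + n.+1%:R * (pi *+ 2) / t) * t = n.+1%:R * (pi *+ 2) + pi.
  by field; rewrite gt_eqF.
rewrite divfK ?gt_eqF// cosDpi cos_period_nat mulr1 mulrN1.
by rewrite divff ?gt_eqF// divr1 ltxx.
Qed.

End oscillating_tail.

(** * A zero of the transform hides the oscillation *)

Section oscillating_product.
Context (R : realType).
Variables (mu : probability R R) (al de t : R).
Hypotheses (al0 : 0 < al) (de0 : 0 < de) (t0 : 0 < t).
Hypothesis mu_pos : {ae mu, forall y, 0 < y}.
Hypothesis mom : mu.-integrable setT (EFin \o (fun y => y `^ (al + de))).
Local Notation W := (fun y : R => y `^ al).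
Hypothesis hcost : cos_transform mu (@ln R) W t = 0.
Hypothesis hsint : sin_transform mu (@ln R) W t = 0.
Local Notation a := (amplitude al t).
Local Notation G := (oscillating_tail al t).

Let a_gt0 : 0 < a.
Proof. by rewrite divr_gt0// mulr_gt0// addr_gt0. Qed.

Let G01 z : 0 <= G z <= 1.
Proof.
have [nu nuE] := oscillating_tail_law al0 t0.
by have := tail_ge0 nu z; have := tail_le1 nu z; rewrite nuE/= => -> ->.
Qed.

Let ratio01 (s : R) : 0 <= (1 + a * cos (s * t)) / (1 + a) <= 1.
Proof.
have a1 : 0 < 1 + a by rewrite addr_gt0.
have [h1 h2] : -1 <= cos (s * t) /\ cos (s * t) <= 1 by rewrite cos_geN1 cos_le1.
have a_lt1 := amplitude_lt1 al0 t0.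
have h3 : a * -1 <= a * cos (s * t) by rewrite ler_pM2l.
have h4 : a * cos (s * t) <= a * 1 by rewrite ler_pM2l.
by rewrite ler_pdivrMr// mul1r divr_ge0 ?(ltW a1)//=; lra.
Qed.

(** The value of [x `^ al * oscillating_tail al t (x / y)] when [y <= x], extended
    to all [y]. Its integral does not depend on [x] since the transform vanishes
    at [t]. *)
Let pure (x y : R) := y `^ al * ((1 + a * cos ((ln x - ln y) * t)) / (1 + a)).

Let tail_approx (x y : R) : 0 < x -> 0 < y ->
  `|x `^ al * G (x / y) - pure x y| <= x `^ (- de) * y `^ (al + de).
Proof.
move=> x0 y0; have z0 : 0 < x / y by exact: divr_gt0.
have lz : ln (x / y) = ln x - ln y by rewrite ln_div.
have e0 : 0 <= x `^ (- de) * y `^ (al + de) by rewrite mulr_ge0 ?powR_ge0.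
have [z1|z1] := lerP 1 (x / y).
  rewrite oscillating_tail_ge1E// lz mulrA.
  have -> : x `^ al * (x / y) `^ (- al) = y `^ al.
    by rewrite !powR_expR// lz -expRD; congr expR; ring.
  by rewrite subrr normr0.
rewrite oscillating_tail_le1E ?(ltW z1)// mulr1 /pure.
have xy : x <= y by rewrite ltr_pdivrMr// mul1r in z1; exact: ltW.
have /andP[r0 r1] := ratio01 (ln x - ln y); move: (_ / _) r0 r1 => r r0 r1.
have xal : x `^ al <= y `^ al by apply: ge0_ler_powR => //; rewrite ?nnegrE ltW.
have xde : x `^ de <= y `^ de by apply: ge0_ler_powR => //; rewrite ?nnegrE ltW.
have y_le : y `^ al <= x `^ (- de) * y `^ (al + de).
  rewrite powRD; last by rewrite gt_eqF ?addr_gt0.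
  by rewrite mulrCA ler_peMr ?powR_ge0// powRN ler_pdivlMl ?powR_gt0// mulr1.
apply: le_trans y_le.
have yr0 : 0 <= y `^ al * r by rewrite mulr_ge0 ?powR_ge0.
have yr1 : y `^ al * r <= y `^ al by rewrite ler_piMr ?powR_ge0.
have xal0 := powR_ge0 x al.
by rewrite ler_norml; apply/andP; split; lra.
Qed.

(** The error made by replacing the tail with [pure] is at most
    [x `^ (- de)] times the moment of order [al + de]. *)
Lemma oscillating_product_tail :
  x `^ al * product_tail mu G x @[x --> +oo] --> (\int[mu]_y W y) / (1 + a).
Proof.
have MW := all_moments_powR al0 de0 mom.
have Wi := all_moments_integrable MW.
have iG (x : R) : mu.-integrable setT (EFin \o (fun y : R => G (x / y))).
  apply: integrable_product_tail.
  - by apply: continuous_measurable_fun; exact: oscillating_tail_continuous.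
  - by move=> z; have /andP[] := G01 z.
  - by move=> z; have /andP[] := G01 z.
have ci := integrable_cosS (@measurable_ln R) t Wi.
have si := integrable_sinS (@measurable_ln R) t Wi.
have pureE (x y : R) : pure x y = (1 + a)^-1 * (y `^ al + a *
    (cos (ln x * t) * (y `^ al * cos (t * ln y)) +
     sin (ln x * t) * (y `^ al * sin (t * ln y)))).
  by rewrite /pure mulrBl cosB [ln y * t]mulrC; ring.
have ics (x : R) : mu.-integrable setT (EFin \o (fun y : R =>
    cos (ln x * t) * (y `^ al * cos (t * ln y)) +
     sin (ln x * t) * (y `^ al * sin (t * ln y)))).
  by apply: integrableRD; exact: integrableRZl.
have iin (x : R) : mu.-integrable setT (EFin \o (fun y : R => y `^ al + a *
    (cos (ln x * t) * (y `^ al * cos (t * ln y)) +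
     sin (ln x * t) * (y `^ al * sin (t * ln y))))).
  by apply: integrableRD => //; exact: integrableRZl.
have ipure (x : R) : mu.-integrable setT (EFin \o pure x).
  by rewrite (funext (pureE x)); exact: integrableRZl.
have int_pure (x : R) : \int[mu]_y pure x y = (\int[mu]_y W y) / (1 + a).
  under eq_Rintegral do rewrite pureE.
  rewrite RintegralZl// RintegralD//; last exact: integrableRZl.
  rewrite RintegralZl// RintegralD//; try exact: integrableRZl.
  rewrite !RintegralZl//.
  rewrite -/(cos_transform mu (@ln R) W t) -/(sin_transform mu (@ln R) W t) hcost hsint.
  by rewrite !mulr0 addr0 mulr0 addr0 mulrC.
pose M := \int[mu]_y (y `^ (al + de)).
have error (x : R) : 0 < x ->
    `|x `^ al * product_tail mu G x - (\int[mu]_y W y) / (1 + a)| <= x `^ (- de) * M.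
  move=> x0; rewrite -(int_pure x) -RintegralZl// -RintegralB//; last exact: integrableRZl.
  have iB : mu.-integrable setT (EFin \o (fun y : R => x `^ al * G (x / y) - pure x y)).
    by apply: integrableRB => //; exact: integrableRZl.
  rewrite (le_trans (le_normr_Rintegral _ iB))// -RintegralZl//.
  apply: ae_le_Rintegral; [exact: integrable_normr|exact: integrableRZl|].
  by apply: filterS mu_pos => y y0; exact: tail_approx.
have bound_cvg : x `^ (- de) * M @[x --> +oo] --> 0 * M.
  by apply: cvgM; [exact: powRN_cvg0|exact: cvg_cst].
rewrite mul0r in bound_cvg.
apply/cvgrPdist_lt => e e0; near=> x.
rewrite distrC (le_lt_trans (error x _))//.
by near: x; exact: (cvgr_lt 0).
Unshelve. all: by end_near. Qed.

End oscillating_product.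

(** The independent pair is the pair of projections of the product of [mu] with
    the oscillating law. *)
Lemma rv_determining_transform_neq0 (R : realType) (mu : probability R R)
    (al de t : R) : 0 < al -> 0 < de -> {ae mu, forall y, 0 < y} ->
  mu.-integrable setT (EFin \o (fun y => y `^ (al + de))) ->
  rv_determining al mu -> 0 < t ->
  cos_transform mu (@ln R) (fun y => y `^ al) t = 0 ->
  sin_transform mu (@ln R) (fun y => y `^ al) t <> 0.
Proof.
move=> al0 de0 mu_pos mom det t0 c0 s0.
have [nu nuE] := oscillating_tail_law al0 t0.
pose Q : probability (R * R)%type R := (mu \x nu)%E.
pose Y : {RV Q >-> R} := HB.pack (fst : R * R -> R) (isMeasurableFun.Build _ _ _ _ _ (@measurable_fst _ _ R R)).
pose Z : {RV Q >-> R} := HB.pack (snd : R * R -> R) (isMeasurableFun.Build _ _ _ _ _ (@measurable_snd _ _ R R)).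
have Q_rect A B : measurable A -> measurable B -> Q (A `*` B) = (mu A * nu B)%E.
  by move=> mA mB; exact: product_measure1E.
have QY A : measurable A -> Q (Y @^-1` A) = mu A.
  move=> mA; rewrite (_ : _ @^-1` _ = A `*` setT).
    by rewrite Q_rect// probability_setT mule1.
  by apply/seteqP; split => z //= [].
have QZ A : measurable A -> Q (Z @^-1` A) = nu A.
  move=> mA; rewrite (_ : _ @^-1` _ = setT `*` A).
    by rewrite Q_rect// probability_setT mul1e.
  by apply/seteqP; split => z //= [].
have indep : independent_RV Y Z.
  by move=> A B mA mB; rewrite QY// QZ// -Q_rect.
have lim := oscillating_product_tail al0 de0 t0 mu_pos mom c0 s0.
have a1 : 0 < 1 + amplitude al t by rewrite addr_gt0// divr_gt0// mulr_gt0// addr_gt0.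
have XRV : regularly_varying Q al (fun w => Y w * Z w).
  exists (fun x => x `^ al * product_tail mu (oscillating_tail al t) x).
    apply: (@slowly_varying_equiv _ (fun=> 1) _ _ (divr_gt0 (mean_powR_gt0 al0 de0 mu_pos mom) a1)).
      split; first exact: nearW.
      by move=> c _; under eq_fun do rewrite divr1; exact: cvg_cst.
    by under eq_fun do rewrite divr1.
  move=> x x0; have -> : Q [set w | x < Y w * Z w] = _ := product_law_tail nu mu_pos x.
  have -> : (fun z => fine (nu [set u | z < u])) = oscillating_tail al t.
    by apply/funext => z; rewrite nuE.
  by rewrite mulrA powRN mulVf ?mul1r// gt_eqF ?powR_gt0.
have [L Lsv LE] := det _ _ Q Y Z QY indep XRV.
apply: (oscillating_not_slowly_varying al0 t0 _ Lsv) => x x1.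
have x0 : 0 < x by exact: lt_le_trans x1.
have := LE x x0; rewrite (_ : [set w | _] = Z @^-1` [set u | x < u])//.
rewrite QZ; last by rewrite -set_itvoy.
rewrite nuE oscillating_tail_ge1E// => -[].
move=> E; have xn0 : x `^ (- al) != 0 by rewrite gt_eqF ?powR_gt0.
by apply: (mulfI xn0); rewrite -E.
Qed.

(** * The characterization *)

Lemma transform_neq0_rv_determining (R : realType) (mu : probability R R)
    (al de : R) : 0 < al -> 0 < de -> {ae mu, forall y, 0 < y} ->
  mu.-integrable setT (EFin \o (fun y => y `^ (al + de))) ->
  (forall x, cos_transform mu (@ln R) (fun y => y `^ al) x ^+ 2 +
             sin_transform mu (@ln R) (fun y => y `^ al) x ^+ 2 != 0) ->
  rv_determining al mu.
Proof.
move=> al0 de0 mu_pos mom nz d T P Y Z Ymu indep [L Lsv LE].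
pose nu : probability R R := distribution P Z.
pose G z := fine (nu [set u | z < u]).
have HL (x : R) : 0 < x -> product_tail mu G x = x `^ (- al) * L x.
  move=> x0; have := LE x x0.
  have -> : P [set w | x < Y w * Z w] = (product_tail mu G x)%:E.
    rewrite -(product_law_tail nu mu_pos x).
    exact: (independent_joint_law Ymu indep (measurable_mul_gt x)).
  by case.
have G_mono z z' : z <= z' -> G z' <= G z by exact: tail_mono.
have lim := tail_equivalence al0 de0 mu_pos mom (measurable_tail nu)
  (tail_ge0 nu) (tail_le1 nu) G_mono Lsv HL nz.
exists (fun x => x `^ al * G x).
  apply: (@slowly_varying_equiv _ L _ (\int[mu]_y (y `^ al))^-1 _ Lsv).
    by rewrite invr_gt0 (mean_powR_gt0 al0 de0 mu_pos mom).
  apply: cvg_trans lim; apply: near_eq_cvg; near=> x.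
  have x0 : 0 < x by [].
  have xa0 : 0 < x `^ al by exact: powR_gt0.
  by rewrite HL// powRN invfM invrK mulrA [G x * _]mulrC.
move=> x x0; rewrite mulrA powRN mulVf ?mul1r; last by rewrite gt_eqF ?powR_gt0.
rewrite fineK//; apply: fin_num_measure.
by rewrite -set_itvoy.
Unshelve. all: by end_near. Qed.

Lemma cexpectation_neq0E d (T : measurableType d) (R : realType)
    (P : probability T R) (Y : {RV P >-> R}) (al t : R) :
  (distribution P Y).-integrable setT (EFin \o (fun y => y `^ al)) ->
  (cexpectation P (fun w => cpowR (Y w) (Complex al t)) != 0) =
  (cos_transform (distribution P Y) (@ln R) (fun y => y `^ al) t ^+ 2 +
   sin_transform (distribution P Y) (@ln R) (fun y => y `^ al) t ^+ 2 != 0).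
Proof.
move=> Wi.
have transfer (f : R -> R) : (distribution P Y).-integrable setT (EFin \o f) ->
    fine 'E_P[fun w => f (Y w)] = \int[distribution P Y]_y f y.
  move=> fi; rewrite unlock; congr fine.
  have mf : measurable_fun setT f by have /measurable_int/measurable_EFinP := fi.
  have mY : measurable_fun setT Y by exact: measurable_funP.
  rewrite /distribution (@integral_pushforward _ _ _ _ _ Y mY P setT (EFin \o f))//.
    exact/measurable_EFinP.
  apply/integrableP; split.
    by apply/measurable_EFinP; exact: measurableT_comp mf mY.
  have /integrableP[_] := fi.
  rewrite /distribution (@ge0_integral_pushforward _ _ _ _ _ Y mY P setT)//.
  by apply: measurableT_comp => //; exact/measurable_EFinP.
rewrite /cexpectation /cpowR/=.
rewrite (transfer (fun y => y `^ al * cos (t * ln y))); last first.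
  exact: (integrable_cosS (@measurable_ln R) t Wi).
rewrite (transfer (fun y => y `^ al * sin (t * ln y))); last first.
  exact: (integrable_sinS (@measurable_ln R) t Wi).
rewrite -/(cos_transform _ _ _ t) -/(sin_transform _ _ _ t).
by rewrite eq_complex/= paddr_eq0 ?sqr_ge0// !sqrf_eq0.
Qed.

Theorem theorem4p2 (R : realType) (d : measure_display)
    (T : measurableType d) (P : probability T R) (Y : {RV P >-> R})
    (alpha : R) (halpha : 0 < alpha)
    (hYpos : {ae P, forall w, 0 < Y w})
    (hYmom : exists2 delta : R, 0 < delta &
       ('E_P[fun w => (Y w `^ (alpha + delta))%R] < +oo)%E) :
  rv_determining alpha (distribution P Y) <->
  (forall theta : R,
     cexpectation P (fun w => cpowR (Y w) (Complex alpha theta)) != 0).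
Proof.
have [de de0 mom0] := hYmom.
pose mu : probability R R := distribution P Y.
have mY : measurable_fun setT Y by exact: measurable_funP.
have mom : mu.-integrable setT (EFin \o (fun y => y `^ (alpha + de))).
  apply/integrableP; split; first by apply/measurable_EFinP; exact: measurable_powR.
  rewrite /mu /distribution (@ge0_integral_pushforward _ _ _ _ _ Y mY P setT)//; last first.
    by apply: measurableT_comp => //; apply/measurable_EFinP; exact: measurable_powR.
  move: mom0; rewrite unlock; apply: le_lt_trans.
  rewrite le_eqVlt; apply/orP; left; apply/eqP; apply: eq_integral => w _ /=.
  by rewrite ger0_norm ?powR_ge0.
have mu_pos : {ae mu, forall y, 0 < y}.
  have mN : measurable [set y : R | y <= 0] by rewrite -set_itvNyc.
  exists [set y : R | y <= 0]; split => //; last first.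
    by move=> y /= /negP; rewrite -leNgt.
  have [N [mN0 N0 YN]] := hYpos.
  apply/eqP; rewrite -measure_le0 -N0.
  change (P (Y @^-1` [set y | (y <= 0)%R]) <= P N)%E.
  apply: le_measure; rewrite ?inE//.
    exact: (measurable_funPTI Y).
  by move=> w /= Yw; apply: YN => /=; apply/negP; rewrite -leNgt.
have Wi := all_moments_integrable (all_moments_powR halpha de0 mom).
split=> [det theta|nz]; last first.
  apply: (transform_neq0_rv_determining halpha de0 mu_pos mom) => x.
  by rewrite -cexpectation_neq0E.
rewrite cexpectation_neq0E//; apply/negP => /eqP/eqP.
rewrite paddr_eq0 ?sqr_ge0// !sqrf_eq0 => /andP[/eqP c0 /eqP s0].
have t0 : theta != 0.
  apply: contra_eq_neq c0 => ->; rewrite gt_eqF// cos_transform0.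
  exact: mean_powR_gt0 halpha de0 mu_pos mom.
have abs_gt0 : 0 < `|theta| by rewrite normr_gt0.
apply: (rv_determining_transform_neq0 halpha de0 mu_pos mom det abs_gt0).
  by case: (ger0P theta) => _; rewrite ?cos_transformN.
by case: (ger0P theta) => _; rewrite ?(sin_transformN (@measurable_ln R) _ Wi) ?s0 ?oppr0.
Qed.
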